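(* Let $0<T<\infty$, $0<\beta<1/2$, and let $A$ and $\epsilon$ be two positive constants. If $y\in{}_0H^\beta(0,T)$ satisfies $$\|\mathrm D_{0+}^\beta y\|_{L^2(0,t)}^2\le\epsilon+A\|y\|_{L^2(0,t)}^2\qquad\text{for all }0<t<T,$$ then $$\|\mathrm D_{0+}^\beta y\|_{L^2(0,t)}\le C\sqrt\epsilon\qquad\text{for all }0<t<T,$$ where $C>0$ is a constant depending only on $\beta$, $A$ and $T$.
   Context: ${}_0H^1(0,T):=\{v\in H^1(0,T): v(0)=0\}$ with norm $\|v'\|_{L^2(0,T)}$, and for $0<\beta<1$, ${}_0H^\beta(0,T):=[L^2(0,T),{}_0H^1(0,T)]_{\beta,2}$ (real interpolation, $K$-method); functions are real valued. For $v\in L^1(0,T)$ and $0<\beta<1$, $\mathrm D_{0+}^\beta v:=\mathrm D\,\mathrm D_{0+}^{\beta-1}v$ is the Riemann-Liouville fractional derivative, where $(\mathrm D_{0+}^{\beta-1}v)(t):=\frac1{\Gamma(1-\beta)}\int_0^t(t-s)^{-\beta}v(s)\,ds$ and $\mathrm D$ is the first-order derivative in the distribution sense. *)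

(* Defs.v *)
From HB Require Import structures.
From mathcomp Require Export all_boot all_order all_algebra.
From mathcomp Require Export all_classical all_reals all_analysis.

Set Implicit Arguments.
Unset Strict Implicit.
Unset Printing Implicit Defensive.

Import Order.TTheory GRing.Theory Num.Theory.
Import numFieldNormedType.Exports.

Local Open Scope classical_set_scope.
Local Open Scope ring_scope.

(* Elements of L^2(0, t) are represented by functions R -> R, of which only the
   restriction to ]0, t[ matters, up to equality almost everywhere; [f \_ D] is
   the extension by zero outside D. *)
Definition L2 (R : realType) (t : R) : set (R -> R) :=
  [set f | (f \_ `]0, t[) \in Lfun (@lebesgue_measure R) 2%:E].

Definition L2norm (R : realType) (t : R) (f : R -> R) : \bar R :=
  Lnorm (@lebesgue_measure R) 2%:E (EFin \o (f \_ `]0, t[)).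

Definition test_fun (R : realType) (t : R) : set (R -> R) :=
  [set phi | [/\ forall n x, derivable (phi^`(n))%classic x 1,
                 compact (closure [set x | phi x != 0])
               & closure [set x | phi x != 0] `<=` `]0, t[ ] ].

(* A distribution on (0, T) is given by its action on [test_fun T]; its values
   on other functions are irrelevant. *)
Definition dist (R : realType) := (R -> R) -> R.

(* D u, for u in L^1(0, T) *)
Definition dist_deriv (R : realType) (T : R) (u : R -> R) : dist R :=
  fun phi => - \int[@lebesgue_measure R]_(x in `]0, T[) (u x * (phi^`())%classic x).

(* The restriction of F to (0, t) is (the regular distribution of) w. *)
Definition dist_represents (R : realType) (t : R) (F : dist R) (w : R -> R) :=
  forall phi, test_fun t phi ->
    F phi = \int[@lebesgue_measure R]_(x in `]0, t[) (w x * phi x).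

(* The L^2(0, t) norm of a distribution: the norm of the (a.e. unique) element
   of L^2(0, t) representing it on (0, t), and +oo when there is none (the
   infimum of the empty set is +oo). *)
Definition dist_L2norm (R : realType) (t : R) (F : dist R) : \bar R :=
  ereal_inf [set L2norm t w | w in [set w | L2 t w /\ dist_represents t F w]].

Definition H1 (R : realType) (T : R) : set (R -> R) :=
  [set v | L2 T v /\ (dist_L2norm T (dist_deriv T v) < +oo)%E].

(* v(0) is the value at 0 of the continuous representative of v. *)
Definition H1_0 (R : realType) (T : R) : set (R -> R) :=
  [set v | H1 T v /\ exists u : R -> R,
    [/\ {within `[0, T], continuous u},
        {ae @lebesgue_measure R, forall x, x \in `]0, T[ -> v x = u x}
      & u 0 = 0] ].

Definition H1_0norm (R : realType) (T : R) (v : R -> R) : \bar R :=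
  dist_L2norm T (dist_deriv T v).

(* Peetre's K-functional of the couple (L^2(0, T), 0H^1(0, T)) *)
Definition Kfun (R : realType) (T s : R) (v : R -> R) : \bar R :=
  ereal_inf [set k | exists v0 v1 : R -> R,
    [/\ L2 T v0, H1_0 T v1,
        {ae @lebesgue_measure R,
           forall x, x \in `]0, T[ -> v x = v0 x + v1 x}
      & k = (L2norm T v0 + s%:E * H1_0norm T v1)%E] ].

Definition Hbeta_0norm (R : realType) (beta T : R) (v : R -> R) : \bar R :=
  ((\int[@lebesgue_measure R]_(s in `]0%R, +oo[)
      (((s `^ (- beta))%:E * Kfun T s v) ^+ 2 * (s^-1)%:E)) `^ 2^-1)%E.

(* As 0H^1 is included in L^2, the sum space of the couple is L^2(0, T). *)
Definition Hbeta_0 (R : realType) (beta T : R) : set (R -> R) :=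
  [set v | L2 T v /\ (Hbeta_0norm beta T v < +oo)%E].

Definition Gamma (R : realType) (x : R) : R :=
  \int[@lebesgue_measure R]_(s in `]0, +oo[) (s `^ (x - 1) * expR (- s)).

(* D_{0+}^{beta-1} v; the integrand is integrable for almost every t. *)
Definition RLint (R : realType) (beta : R) (v : R -> R) : R -> R :=
  fun t => (Gamma (1 - beta))^-1 *
    \int[@lebesgue_measure R]_(s in `]0, t[) ((t - s) `^ (- beta) * v s).

Definition RLderiv (R : realType) (T beta : R) (v : R -> R) : dist R :=
  dist_deriv T (RLint beta v).

(* Main.v *)
From HB Require Import structures.
Require Import Defs.
From mathcomp Require Import ring lra measurable_realfun.

Import Order.TTheory GRing.Theory Num.Theory.
Import numFieldNormedType.Exports.

Local Open Scope classical_set_scope.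
Local Open Scope ring_scope.

(** The assumed inequality is turned into a Gronwall inequality for the fractional
derivative alone, by bounding [y] on [(0, s)] in terms of that derivative.

Let [u] be the Abel convolution of [y] with the kernel [x_+^(-beta)]. Since
[beta < 1/2] this kernel is locally square integrable, and the Cauchy-Schwarz
inequality makes [u] Hoelder continuous with [u 0 = 0] ([conv_abel_holder]). Let
[w] be a square integrable representative of the fractional derivative on
[(0, t)]. Testing with smooth plateaus that converge to the indicator of [(0, b]]
turns the weak identity into [u b = Gamma (1 - beta) * \int_0^b w]
([weak_deriv_primitive], [RL_primitive]). In particular [w] is unique almost
everywhere, so the norm of the distribution is the norm of [w]
([dist_L2norm_eq]). Convolving once more, with [x_+^(beta - 1)], and exchanging
the integrals solves Abel's equation: up to a constant, [y] is the convolution of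
[w] with [x_+^(beta - 1)] ([RL_inversion]).

The Cauchy-Schwarz inequality for the weight [(s - r)^(beta - 1)] and Tonelli's
theorem then bound the squared norm of [y] on [(0, s)] by a multiple of
[\int_0^s (s - r)^beta * w(r)^2 dr] ([integral_conv_sqr]). Cutting this integral
at [r = s - d] gives, for [phi s = \int_0^s w^2], an inequality

  [phi s <= eps + K1 * phi (s - d) + K2 * d^beta * phi s]

([energy_split], [L2norm_le_energy]). For [d] small the last term is absorbed in
the left-hand side, and about [T / d] iterations starting from [phi s = 0] for
[s <= 0] bound [phi] by a multiple of [eps] ([delay_gronwall]). *)

(** * Affine changes of variable *)

Lemma measurable_affine {R : realType} (c a : R) :
  measurable_fun [set: R] (fun x : R => c * x + a).
Proof. by apply: measurable_funD. Qed.

Section affine.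
Context {R : realType}.
Notation mu := (@lebesgue_measure R).

(** The existential packages the push-forward as a measure, which the uniqueness
theorem for the Lebesgue measure requires. *)
Lemma affine_measure (c a : R) :
  exists m : {measure set (measurableTypeR R) -> \bar R},
    forall A, m A = mu ((fun x => (c * x + a)%R) @^-1` A).
Proof.
unshelve eexists.
  unshelve refine (pushforward mu (fun x : measurableTypeR R => (c * x + a : measurableTypeR R)) : measure _ _).
  exact: measurable_affine.
by [].
Qed.

Lemma lebesgue_measure_affine (c a : R) (A : set R) : c != 0 -> measurable A ->
  mu A = (`|c|%:E * mu ((fun x => (c * x + a)%R) @^-1` A))%E.
Proof.
move=> c0 mA.
have [m mE] := affine_measure c a.
suff -> : mu A = mscale (NngNum (normr_ge0 c)) m A by rewrite /mscale mE.
apply: lebesgue_measure_unique => //= _ [[u v]] _ <-.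
rewrite /mscale /= mE.
have [c1|c1|] := ltrgtP 0 c; last by move=> c1; rewrite -c1 eqxx in c0.
- rewrite (_ : _ @^-1` _ = `](u - a) / c, (v - a) / c]%classic); last first.
    apply/seteqP; split => x; rewrite /= !in_itv /= ler_pdivlMr// ltr_pdivrMr//;
    clear mE m; rewrite mulrC; lra.
  rewrite !lebesgue_measure_itv/= !lte_fin.
  rewrite ltr_pM2r ?invr_gt0// ltrD2r; case: ifPn => [uv|]; last by rewrite mule0.
  rewrite gtr0_norm// -!EFinB -EFinM; congr EFin; by clear mE m; field.
- rewrite (_ : _ @^-1` _ = `[(v - a) / c, (u - a) / c[%classic); last first.
    apply/seteqP; split => x; rewrite /= !in_itv /= ler_ndivrMr// ltr_ndivlMr//;
    clear mE m; rewrite mulrC; lra.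
  rewrite !lebesgue_measure_itv/= !lte_fin.
  rewrite ltr_nM2r ?invr_lt0// ltrD2r; case: ifPn => [uv|]; last by rewrite mule0.
  rewrite ltr0_norm// -!EFinB -EFinM; congr EFin; by clear mE m; field.
Qed.

Lemma ge0_integral_affine (c a : R) (f : R -> \bar R) : c != 0 ->
  measurable_fun setT f -> (forall x, (0 <= f x)%E) ->
  (\int[mu]_x f x = `|c|%:E * \int[mu]_x f (c * x + a)%R)%E.
Proof.
move=> c0 mf f0.
have [m mE] := affine_measure c a.
rewrite (eq_measure_integral (mscale (NngNum (normr_ge0 c)) m)); last first.
  move=> A mA _; rewrite [LHS](lebesgue_measure_affine _ a _ c0)//.
  by rewrite -(mE A).
rewrite ge0_integral_mscale//=; congr (_ * _)%E.
rewrite (eq_measure_integral (pushforward mu ((fun x : measurableTypeR R => (c * x + a : measurableTypeR R))))).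
- exact: measurable_affine.
- by move=> mphi; rewrite ge0_integral_pushforward.
- by move=> mphi B mB _; exact: mE.
Qed.
End affine.

(** * Abel kernels *)

(** The kernel [x_+^(a - 1)] of the Riemann-Liouville integral of order [a], without
its factor [1 / Gamma a]. For [a = 1] it is the Heaviside function, so that
convolving with [abel 1] integrates from the left. *)
Definition abel {R : realType} (a x : R) : R := if 0 < x then x `^ (a - 1) else 0.

Section kernels.
Context {R : realType}.
Notation mu := (@lebesgue_measure R).
Implicit Types a b x : R.

Lemma abel_ge0 a x : 0 <= abel a x.
Proof. by rewrite /abel; case: ifP => // _; exact: powR_ge0. Qed.

Lemma abel_le0E a x : x <= 0 -> abel a x = 0.
Proof. by rewrite /abel ltNge => ->. Qed.

Lemma abel_gt0E a x : 0 < x -> abel a x = x `^ (a - 1).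
Proof. by rewrite /abel => ->. Qed.

Lemma measurable_abel a : measurable_fun setT (abel a).
Proof.
rewrite /abel; apply: measurable_fun_ifT => //.
exact: measurable_fun_ltr.
Qed.

Lemma integral_abel_itv a (e b : R) : 0 < a -> 0 < e -> e < b ->
  (\int[mu]_(x in `[e, b]) (abel a x)%:E = (abel (a + 1) b / a - abel (a + 1) e / a)%:E)%E.
Proof.
move=> a0 e0 eb.
have b0 : 0 < b by lra.
have dF x : 0 < x -> is_derive x 1 (fun x => x `^ a / a) (x `^ (a - 1)).
  move=> x0.
  rewrite (_ : x `^ (a - 1) = a^-1 * (a * x `^ (a - 1))); last by field; lra.
  rewrite (_ : (fun x => _) = a^-1 \*: (fun x => x `^ a)); last first.
    by apply/funext => z /=; rewrite mulrC.
  by apply: is_deriveZ; exact: is_derive1_powR.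
have cF x : 0 < x -> {for x, continuous (fun x => x `^ a / a)}.
  by move=> x0; apply: differentiable_continuous; apply/derivable1_diffP; apply: (@ex_derive _ _ _ _ _ _ _ (dF x x0)).
rewrite (_ : (\int[mu]_(x in _) _)%E = \int[mu]_(x in `[e, b]) (x `^ (a - 1))%:E)%E; last first.
  apply: eq_integral => x; rewrite inE/= in_itv/= => /andP[ex _].
  by rewrite abel_gt0E//; lra.
rewrite (@continuous_FTC2 _ _ (fun x => x `^ a / a))//.
- rewrite !abel_gt0E ?addrK// EFinB.
- apply: continuous_in_subspaceT => x; rewrite inE/= in_itv/= => /andP[ex _].
  apply: differentiable_continuous; apply/derivable1_diffP. apply: derivable_powR; rewrite in_itv/= andbT; lra.
- split.
  + move=> x; rewrite in_itv/= => /andP[ex _]; apply: (@ex_derive _ _ _ _ _ _ _ (dF x _)); lra.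
  + by apply: cvg_at_right_filter; apply: cF.
  + by apply: cvg_at_left_filter; apply: cF.
- move=> x; rewrite in_itv/= => /andP[ex _]; rewrite derive1E.
  by apply: (@derive_val _ _ _ _ _ _ _ (dF x _)); lra.
Qed.

(** The integrand may blow up at [0], where the fundamental theorem of calculus does
not apply directly: the value is the monotone limit over [[b / (n + 2), b]]. *)
Lemma integral_abel a b : 0 < a ->
  (\int[mu]_(x in `]-oo, b[) (abel a x)%:E = (abel (a + 1) b / a)%:E)%E.
Proof.
move=> a0; have [b0|b0] := leP b 0.
  rewrite abel_le0E// mul0r integral0_eq// => x /=; rewrite in_itv/= => xb.
  by rewrite abel_le0E//; lra.
rewrite integral_itv_bndo_bndc; last first.
  by apply/measurable_EFinP; apply: measurable_funTS; exact: measurable_abel.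
pose e n := b / n.+2%:R.
have e0 n : 0 < e n by rewrite divr_gt0.
have eb n : e n < b by rewrite ltr_pdivrMr// ltr_pMr// ltr1n.
have -> : (\int[mu]_(x in `]-oo, b]) (abel a x)%:E =
          \int[mu]_(x in \bigcup_n `[e n, b]%classic) (abel a x)%:E)%E.
  rewrite integral_mkcond [RHS]integral_mkcond; apply: eq_integral => x _.
  rewrite !patchE; case: ifPn; rewrite ?inE/= ?in_itv/= => xb.
    case: ifPn => //; rewrite notin_setE => nx.
    rewrite abel_le0E// leNgt; apply/negP => x0; apply: nx.
    (* any [n] with [b / x < n + 2] puts [x] in the [n]-th interval *)
    pose n := Num.truncn (b / x); exists n => //=; rewrite in_itv/= xb andbT.
    rewrite /e ler_pdivrMr// mulrC -ler_pdivrMr// ltW//.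
    apply: lt_trans (truncnS_gt _) _; by rewrite ltr_nat.
  by case: ifPn => //; rewrite inE => -[n _] /=; rewrite in_itv/= => /andP[_ xb']; rewrite notin_setE/= in_itv/= xb' in xb.
have h : (\int[mu]_(x in `[e i, b]) (abel a x)%:E @[i --> \oo] -->
          \int[mu]_(x in \bigcup_i `[e i, b]%classic) (abel a x)%:E)%E.
  apply: ge0_nondecreasing_set_cvg_integral.
  - apply/nondecreasing_seqP => n; rewrite subsetEset => x /=; rewrite !in_itv/= => /andP[ex ->]; rewrite andbT.
    by apply: le_trans ex; rewrite /e ler_pM2l// lef_pV2 ?posrE// ler_nat.
  - by [].
  - by move=> i; apply/measurable_EFinP; apply: measurable_funTS; exact: measurable_abel.
  - by move=> i x _; rewrite lee_fin abel_ge0.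
rewrite -(cvg_lim _ h)//; apply/cvg_lim => //.
under eq_fun do rewrite integral_abel_itv//.
apply: cvg_EFin; first by near=> n.
rewrite [X in _ --> X](_ : _ = abel (a + 1) b / a - 0 / a); last by rewrite mul0r subr0.
apply: cvgB; first exact: cvg_cst.
apply: cvgMl.
have := powR_cvg0 a0 => /cvg_at_rightP /(_ e) /= h'.
under eq_fun do rewrite abel_gt0E// addrK.
apply: h'; split => //.
rewrite /e -(mulr0 b).
apply: cvgMr.
by have := @cvg_harmonic R; rewrite -cvg_shiftS.
Unshelve. all: by end_near. Qed.

Definition kconv (k l : R -> R) x : \bar R := (\int[mu]_z (k (x - z) * l z)%:E)%E.

Lemma measurable_subl x (k : R -> R) : measurable_fun setT k ->
  measurable_fun setT (fun z : R => k (x - z)).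
Proof.
move=> mk.
apply: (measurableT_comp mk).
exact: measurable_funB.
Qed.

Lemma kconvC (k l : R -> R) x : measurable_fun setT k -> measurable_fun setT l ->
  (forall z, 0 <= k z) -> (forall z, 0 <= l z) -> kconv k l x = kconv l k x.
Proof.
move=> mk ml k0 l0; rewrite /kconv.
rewrite (@ge0_integral_affine _ (-1) x)//=.
- rewrite normrN1 mul1e; apply: eq_integral => z _.
  by rewrite mulrC; congr (_ * _)%:E; congr (_ _); ring.
- by apply/measurable_EFinP; apply: measurable_funM => //; exact: measurable_subl.
- by move=> z; rewrite lee_fin mulr_ge0.
Qed.

Lemma measurable_abelM a b x :
  measurable_fun setT (fun z : R => (abel a (x - z) * abel b z)%:E).
Proof.
apply/measurable_EFinP; apply: measurable_funM; last exact: measurable_abel.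
apply: measurable_subl; exact: measurable_abel.
Qed.

Lemma abel1E x : abel 1 x = (0 < x)%R%:R :> R.
Proof. by rewrite /abel subrr powRr0; case: ifP. Qed.

(** Convolving with [abel 1] gives the primitive [x_+^a / a] of the kernel. *)
Lemma kconv_abel1l a x : 0 < a -> kconv (abel 1) (abel a) x = (abel (a + 1) x / a)%:E.
Proof.
move=> a0; rewrite -integral_abel// /kconv [RHS]integral_mkcond.
apply: eq_integral => z _; rewrite patchE abel1E subr_gt0.
by case: ifPn; rewrite ?inE ?notin_setE/= in_itv/=; case: (ltP z x) => //; rewrite ?mul1r ?mul0r.
Qed.

Lemma kconv_abel1r a x : 0 < a -> kconv (abel a) (abel 1) x = (abel (a + 1) x / a)%:E.
Proof.
move=> a0; rewrite kconvC ?kconv_abel1l//; try exact: measurable_abel; move=> *; exact: abel_ge0.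
Qed.

(** Euler's Beta integral. *)
Definition beta_int a b : R := fine (kconv (abel a) (abel b) 1).

Lemma abel_ge1 a x : a <= 1 -> 0 < x <= 1 -> 1 <= abel a x.
Proof.
move=> a1 /andP[x0 x1]; rewrite abel_gt0E// -[leLHS](powRr0 x).
by apply: ger_powR; rewrite ?x0 ?x1//; lra.
Qed.

Lemma abel_le2 a x : 0 <= a -> a <= 1 -> 2^-1 <= x -> x <= 1 -> abel a x <= 2.
Proof.
move=> a0 a1 x2 x1; have x0 : 0 < x by lra.
rewrite abel_gt0E//; apply: (@le_trans _ _ (x `^ (- 1))).
  by apply: ger_powR; rewrite ?x0 ?x1//; lra.
by rewrite powR_inv1 ?(ltW x0)// invf_ple ?posrE.
Qed.

(** On [(0, 1)] both factors are at least [1], whence the lower bound; one of [z] and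
[1 - z] is at least [1/2], where the corresponding factor is at most [2], so the
product is dominated by twice the sum of the two kernels. *)
Lemma beta_int_spec a b : 0 < a <= 1 -> 0 < b <= 1 ->
  kconv (abel a) (abel b) 1 = (beta_int a b)%:E /\ 1 <= beta_int a b.
Proof.
move=> /andP[a0 a1] /andP[b0 b1].
have ge1 : (1 <= kconv (abel a) (abel b) 1)%E.
  have -> : (1 = \int[mu]_(x in `]0%R, 1%R[) (cst 1) x :> \bar R)%E.
    by rewrite integral_cst//= lebesgue_measure_itv/= lte_fin ltr01 oppr0 adde0 mul1e.
  rewrite integral_mkcond; apply: ge0_le_integral => //.
  - by move=> z _; rewrite patchE; case: ifP => //; rewrite lee_fin.
  - by apply/(measurable_restrictT _ _).1.
  - exact: measurable_abelM.
  - move=> z _; rewrite patchE; case: ifPn; rewrite ?inE/= ?in_itv/=.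
      by move=> /andP[z0 z1]; rewrite lee_fin -[leLHS]mulr1 ler_pM// abel_ge1//; lra.
    by move=> _; rewrite lee_fin mulr_ge0 ?abel_ge0.
have fin : (kconv (abel a) (abel b) 1 < +oo)%E.
  have Ha := kconv_abel1r a 1 a0; have Hb := kconv_abel1l b 1 b0.
  have : (2%:E * (kconv (abel a) (abel 1) 1 + kconv (abel 1) (abel b) 1) < +oo)%E.
    by rewrite Ha Hb -EFinD -EFinM ltry.
  apply: le_lt_trans.
  rewrite /kconv -ge0_integralD//=.
  - rewrite -ge0_integralZl//=.
    + apply: ge0_le_integral => //=.
      * by move=> z _; rewrite lee_fin mulr_ge0 ?abel_ge0.
      * exact: measurable_abelM.
      * apply: measurable_funeM; apply: emeasurable_funD; exact: measurable_abelM.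
      * move=> z _; rewrite -EFinD -EFinM lee_fin !abel1E subr_gt0.
        have [z0|z0] := ltP 0 z; last by rewrite (abel_le0E b _ z0) !mulr0 addr0 mulr0.
        have [z1|z1] := ltP z 1; last by rewrite (abel_le0E a) ?mul0r ?add0r ?mulr0//; lra.
        rewrite mulr1 mul1r.
        have ka := abel_ge0 a (1 - z); have kb := abel_ge0 b z.
        (* if [z <= 1/2] then [1 - z >= 1/2], and conversely *)
        have [z2|z2] := leP z 2^-1.
          have : abel a (1 - z) <= 2 by apply: abel_le2; lra.
          nra.
        have : abel b z <= 2 by apply: abel_le2; lra.
        nra.
    + by apply: emeasurable_funD; exact: measurable_abelM.
    + by move=> z _; rewrite -EFinD lee_fin addr_ge0// mulr_ge0 ?abel_ge0.
  - by move=> z _; rewrite lee_fin mulr_ge0 ?abel_ge0.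
  - exact: measurable_abelM.
  - by move=> z _; rewrite lee_fin mulr_ge0 ?abel_ge0.
  - exact: measurable_abelM.
have E : kconv (abel a) (abel b) 1 = (beta_int a b)%:E.
  by rewrite fineK// ge0_fin_numE// (le_trans _ ge1).
by split => //; rewrite -lee_fin -E.
Qed.

(** The scaling [z = x * z'] reduces the convolution at [x] to its value at [1]. *)
Lemma kconv_abel a b x : 0 < a <= 1 -> 0 < b <= 1 ->
  kconv (abel a) (abel b) x = (beta_int a b * abel (a + b) x)%:E.
Proof.
move=> a01 b01; have [fE _] := beta_int_spec a b a01 b01.
have [x0|x0] := leP x 0.
  rewrite abel_le0E// mulr0 /kconv integral0_eq// => z _.
  have [z0|z0] := leP z 0; first by rewrite (abel_le0E b _ z0) mulr0.
  by rewrite (@abel_le0E a) ?mul0r//; lra.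
rewrite /kconv (@ge0_integral_affine _ x 0)//=.
- rewrite gtr0_norm//.
  under eq_integral => z _.
    rewrite (_ : (abel _ _ * _)%R = (x `^ (a + b - 2)) * (abel a (1 - z) * abel b z)); last first.
      rewrite addr0 -[X in X - _]mulr1 -mulrBr /abel.
      rewrite !pmulr_rgt0//; case: ifPn => h1; last by rewrite !mul0r mulr0.
      case: ifPn => h2; last by rewrite !mulr0.
      rewrite !powRM ?ltW// mulrACA -powRD ?(lt0r_neq0 x0) ?implybT//.
      by congr (_ `^ _ * _); ring.
    rewrite EFinM.
  over.
  rewrite ge0_integralZl//=.
  + rewrite [X in (_ * (_ * X))%E]fE -!EFinM; congr EFin.
    rewrite abel_gt0E// mulrA mulrC; congr (_ * _).
    rewrite -{1}(powRr1 (ltW x0)) -powRD ?(lt0r_neq0 x0) ?implybT//; congr (_ `^ _); ring.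
  + exact: measurable_abelM.
  + by move=> z _; rewrite lee_fin mulr_ge0 ?abel_ge0.
  + by rewrite lee_fin powR_ge0.
- by rewrite gt_eqF.
- exact: measurable_abelM.
- by move=> z; rewrite lee_fin mulr_ge0 ?abel_ge0.
Qed.
End kernels.
(** * Convolution of a function with a kernel *)

Section conv.
Context {R : realType}.
Notation mu := (@lebesgue_measure R).
Implicit Types (k l F : R -> R) (t : R).

Definition conv k F t : R := \int[mu]_s (k (t - s) * F s).

Lemma measurable_fubini (Psi : R * R -> \bar R) : measurable_fun setT Psi ->
  measurable_fun setT (fun t => \int[mu]_s Psi (t, s))%E.
Proof.
move=> mP.
under eq_fun do rewrite integralE.
apply: emeasurable_funB.
- have h := @measurable_fun_fubini_tonelli_F _ _ (measurableTypeR R) (measurableTypeR R) R mu _ (measurable_funepos mP) (funepos_ge0 _).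
  rewrite (_ : (fun x => _) = fubini_F mu (Psi^\+)%E); first exact: h.
  by apply/funext => x; rewrite /fubini_F; apply: eq_integral => y _; rewrite unlock.
- have h := @measurable_fun_fubini_tonelli_F _ _ (measurableTypeR R) (measurableTypeR R) R mu _ (measurable_funeneg mP) (funeneg_ge0 _).
  rewrite (_ : (fun x => _) = fubini_F mu (Psi^\-)%E); first exact: h.
  by apply/funext => x; rewrite /fubini_F; apply: eq_integral => y _; rewrite unlock.
Qed.

Lemma measurable_convand l F : measurable_fun setT l -> measurable_fun setT F ->
  measurable_fun setT (fun p : R * R => l (p.1 - p.2) * F p.2).
Proof.
move=> ml mF; apply: measurable_funM.
- by apply: (measurableT_comp ml); apply: measurable_funB.
- exact: (measurableT_comp mF).
Qed.

Lemma measurable_conv l F : measurable_fun setT l -> measurable_fun setT F ->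
  measurable_fun setT (conv l F).
Proof.
move=> ml mF; apply: (measurableT_comp (f := fine)) => //.
apply: (measurable_fubini (fun p : R * R => (l (p.1 - p.2) * F p.2)%:E)).
by apply/measurable_EFinP; exact: measurable_convand.
Qed.

Lemma measurable_conv3 k l F t : measurable_fun setT k -> measurable_fun setT l ->
  measurable_fun setT F ->
  measurable_fun setT (fun p : R * R => k (t - p.1) * (l (p.1 - p.2) * F p.2)).
Proof.
move=> mk ml mF; apply: measurable_funM; last exact: measurable_convand.
by apply: (measurableT_comp mk); apply: measurable_funB.
Qed.

Lemma kconv_shift k l t s : measurable_fun setT k -> measurable_fun setT l ->
  (forall z, 0 <= k z) -> (forall z, 0 <= l z) ->
  (\int[mu]_x (k (t - x) * l (x - s))%:E = kconv k l (t - s))%E.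
Proof.
move=> mk ml k0 l0.
rewrite (@ge0_integral_affine _ 1 s)//=.
- rewrite normr1 mul1e; apply: eq_integral => x _.
  by congr (k _ * l _)%:E; ring.
- apply/measurable_EFinP; apply: measurable_funM.
  + exact: measurable_subl.
  + by apply: (measurableT_comp ml); apply: measurable_funB.
- by move=> x; rewrite lee_fin mulr_ge0.
Qed.

Lemma kconv_tonelli k l F kl t : measurable_fun setT k -> measurable_fun setT l ->
  measurable_fun setT F -> (forall z, 0 <= k z) -> (forall z, 0 <= l z) ->
  (forall z, 0 <= F z) -> (forall z, kconv k l z = (kl z)%:E) ->
  (\int[mu]_x ((k (t - x))%:E * \int[mu]_s (l (x - s) * F s)%:E) =
   \int[mu]_s (kl (t - s) * F s)%:E)%E.
Proof.
move=> mk ml mF k0 l0 F0 klE.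
transitivity (\int[mu]_x \int[mu]_s (k (t - x) * (l (x - s) * F s))%:E)%E.
  apply: eq_integral => x _; rewrite -ge0_integralZl//=.
  - apply/measurable_EFinP; apply: measurable_funM => //.
    exact: measurable_subl.
  - by move=> s _; rewrite lee_fin mulr_ge0.
  - by rewrite lee_fin.
rewrite (@fubini_tonelli _ _ (measurableTypeR R) (measurableTypeR R) R mu mu (fun p : R * R => (k (t - p.1) * (l (p.1 - p.2) * F p.2))%:E)) /=.
- apply: eq_integral => s _.
  under eq_integral do rewrite mulrA EFinM.
  rewrite ge0_integralZr//=.
  + by rewrite kconv_shift// klE EFinM.
  + apply/measurable_EFinP; apply: measurable_funM.
    * exact: measurable_subl.
    * by apply: (measurableT_comp ml); apply: measurable_funB.
  + by move=> x _; rewrite lee_fin mulr_ge0.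
  + by rewrite lee_fin.
- by apply/measurable_EFinP; exact: measurable_conv3.
- by move=> x; rewrite lee_fin !mulr_ge0.
Qed.

(** Associativity of convolution, the heart of the inversion of Abel's equation. The
inner convolution of a merely integrable function converges only almost
everywhere, which Fubini's theorem tolerates. *)
Lemma conv_conv k l F kl t : measurable_fun setT k -> measurable_fun setT l ->
  measurable_fun setT F -> (forall z, 0 <= k z) -> (forall z, 0 <= l z) ->
  (forall z, kconv k l z = (kl z)%:E) ->
  mu.-integrable setT (fun s => (kl (t - s) * F s)%:E) ->
  conv k (conv l F) t = conv kl F t.
Proof.
move=> mk ml mF k0 l0 klE ikl.
pose P := fun p : R * R => (k (t - p.1) * (l (p.1 - p.2) * F p.2))%:E.
have kl0 z : 0 <= kl z.
  by rewrite -lee_fin -klE integral_ge0// => x _; rewrite lee_fin mulr_ge0.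
have mP : measurable_fun setT P by apply/measurable_EFinP; exact: measurable_conv3.
have iP : (mu \x mu)%E.-integrable setT P.
  apply/integrable21ltyP => //.
  have /integrableP[_] := ikl; apply: le_lt_trans.
  rewrite le_eqVlt; apply/orP; left; apply/eqP; apply: eq_integral => s _.
  rewrite /P /=.
  under eq_integral do rewrite mulrA normrM EFinM (ger0_norm (mulr_ge0 _ _))//.
  rewrite ge0_integralZr//=.
  - by rewrite kconv_shift// klE normrM EFinM (ger0_norm (kl0 _)).
  - apply/measurable_EFinP; apply: measurable_funM.
    + exact: measurable_subl.
    + by apply: (measurableT_comp ml); apply: measurable_funB.
  - by move=> x _; rewrite lee_fin mulr_ge0.
rewrite /conv /Rintegral; congr fine.
transitivity (\int[mu]_x \int[mu]_s P (x, s))%E.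
  apply: ae_eq_integral => //.
  - apply/measurable_EFinP; apply: measurable_funM; first exact: measurable_subl.
    exact: measurable_conv.
  - exact: measurable_fubini.
  - have := ae_integrable1 iP; apply: filterS => x /= ix _.
    (* where [k] vanishes the inner integral need not converge *)
    have [kx0|kx0] := eqVneq (k (t - x)) 0.
      rewrite kx0 mul0r integral0_eq// => s _.
      by rewrite /P /= kx0 mul0r.
    have il : mu.-integrable setT (fun s => (l (x - s) * F s)%:E).
      have := @integrableZl _ _ _ mu setT measurableT (k (t - x))^-1 _ ix.
      apply: eq_integrable => // s _.
      by rewrite /P /= -EFinM mulKf.
    rewrite EFinM fineK; last exact: integrable_fin_num.
    rewrite -integralZl//=.
rewrite Fubini//; apply: eq_integral => s _.
rewrite /P /=.
under eq_integral do rewrite mulrA EFinM.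
rewrite integralZr//=.
- by rewrite kconv_shift// klE EFinM.
- apply/integrableP; split.
    apply/measurable_EFinP; apply: measurable_funM.
    + exact: measurable_subl.
    + by apply: (measurableT_comp ml); apply: measurable_funB.
  under eq_integral do rewrite gee0_abs ?lee_fin ?mulr_ge0//.
  by rewrite kconv_shift// klE ltry.
Qed.
End conv.
(** * A smooth step function *)

Section smooth_step.
Context {R : realType}.
Implicit Types (p : {poly R}) (x y : R) (f : R -> R).

Lemma is_derive_eqfun f g x (d d' : R) :
  is_derive x 1 f d -> f =1 g -> d = d' -> is_derive x 1 g d'.
Proof. by move=> df /funext <- <-. Qed.

Lemma scaleRE (a b : R) : a *: b = a * b. Proof. by []. Qed.

(** An arbitrary rate [d] makes the induction on the polynomial go through: one
more factor [y] is paid with half of the rate. *)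
Lemma horner_le_expR p (d : R) : 0 < d ->
  exists2 C, 0 <= C & forall y, 0 <= y -> `|p.[y]| <= C * expR (d * y).
Proof.
elim/poly_ind: p d => [|p c IH] d d0.
  by exists 0 => // y _; rewrite horner0 normr0 mul0r.
have d20 : 0 < d / 2 by lra.
have [C C0 hC] := IH _ d20.
exists (C * (d / 2)^-1 + `|c|).
  by rewrite addr_ge0// mulr_ge0// invr_ge0; lra.
move=> y y0; rewrite hornerMXaddC mulrDl.
apply: (le_trans (ler_normD _ _)); apply: lerD.
- rewrite normrM (ger0_norm y0) (_ : d * y = d / 2 * y + d / 2 * y); last by field.
  rewrite expRD mulrACA; apply: ler_pM => //; first exact: hC.
  rewrite ler_pdivlMl//; have := expR_ge1Dx (d / 2 * y); lra.
- rewrite -{1}(mulr1 `|c|) ler_wpM2l// -expR0 ler_expR mulr_ge0//; lra.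
Qed.

(** For [p = 1] this is the standard smooth function flat at [0]; with all polynomials
[p] the family becomes stable under derivation. *)
Definition flat p x : R := if 0 < x then p.[x^-1] * expR (- x^-1) else 0.

Definition flat_deriv p : {poly R} := 'X^2 * (p - p^`()).

Lemma is_derive_flat p x : is_derive x 1 (flat p) (flat (flat_deriv p) x).
Proof.
have [x0|x0|x0] := ltrgtP 0 x.
- have -> : flat (flat_deriv p) x =
    (p^`()).[x^-1] * (- x ^- 2) * expR (- x^-1) + p.[x^-1] * (expR (- x^-1) * - (- x ^- 2)).
    by rewrite /flat x0 /flat_deriv hornerM hornerXn hornerD hornerN exprVn; ring.
  have dV : is_derive x 1 (fun z : R => z^-1) (- x ^- 2).
    have := @is_deriveV _ id x 1 1; rewrite /= scaler1; apply.
    by rewrite gt_eqF.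
  have dp : is_derive (x^-1) 1 (horner p) ((p^`()).[x^-1]).
    split; first exact: derivable_horner.
    by rewrite derivE derive1E.
  have d1 := is_derive1_comp dp dV.
  have dN : is_derive x 1 (fun z : R => - z^-1) (- (- x ^- 2)) by exact: is_deriveN.
  have d2 := @is_derive1_comp _ expR (fun z : R => - z^-1) _ _ _ (is_derive_expR (- x^-1)) dN.
  have d3 := is_deriveM d1 d2.
  have {d3} : is_derive x 1 (flat p) _ := near_eq_is_derive _ d3.
  move=> /(_ _) d3; apply: (is_derive_eqfun _ _ _ _ _ (d3 _)) => //.
    near=> z; rewrite /flat ifT//; near: z; exact: lt_nbhsr.
  by rewrite /= !scaleRE; ring.
- rewrite /flat ltNge (ltW x0)/=.
  apply: (near_eq_is_derive _ (is_derive_cst (0:R) x 1)).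
  near=> z; rewrite /flat ltNge ifF//; apply/negbF/ltW; near: z; exact: lt_nbhsl.
- rewrite -x0 [X in is_derive _ _ _ X](_ : _ = 0); last by rewrite /flat ltxx.
  have [C C0 hC] := horner_le_expR ('X^2 * p) 1 ltr01.
  have hb z : `|flat p z| <= C * z ^+ 2.
    rewrite /flat; case: ifPn => [z0|]; last by rewrite normr0 mulr_ge0// sqr_ge0.
    have zi : 0 <= z^-1 by rewrite invr_ge0 ltW.
    have := hC _ zi; rewrite hornerM hornerXn mul1r normrM.
    rewrite (ger0_norm (sqr_ge0 _)) normrM (ger0_norm (expR_ge0 _)) expRN.
    rewrite exprVn mulrC ler_pdivrMr ?exprn_gt0// => h.
    by rewrite ler_pdivrMr ?expR_gt0// mulrAC.
  have cv : h^-1 *: ((flat p \o shift 0) (h *: 1) - flat p 0) @[h --> 0^'] --> (0 : R).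
    apply/cvgrPdist_le => e e0; near=> h.
    have -> : (flat p \o shift 0) (h *: 1) = flat p h.
      by rewrite /= addr0 scaleRE mulr1.
    rewrite sub0r normrN [flat p 0]/flat ltxx subr0 scaleRE.
    rewrite normrM normfV ler_pdivrMl; last by rewrite normr_gt0; near: h; exact: nbhs_dnbhs_neq.
    apply: le_trans (hb h) _.
    rewrite -real_normK ?num_real// expr2 mulrA mulrC ler_wpM2l//.
    have h1 : `|h| <= e / (C + 1).
      near: h; apply: dnbhs0_le; rewrite divr_gt0//; lra.
    apply: (@le_trans _ _ ((C + 1) * `|h|)); first by rewrite ler_wpM2r//; lra.
    by rewrite mulrC -ler_pdivlMr//; lra.
  split; first by apply/cvg_ex; exists 0.
  by rewrite /derive; apply/cvg_lim.
Unshelve. all: by end_near. Qed.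

(** A syntax of smooth functions stable under derivation: smoothness of every member
follows by induction, without a general theory of higher derivatives. *)
Inductive smooth_expr : (R -> R) -> Prop :=
| SE_flat p : smooth_expr (flat p)
| SE_affine f (a b : R) : smooth_expr f -> smooth_expr (fun x => f (a * x + b))
| SE_scale f (a : R) : smooth_expr f -> smooth_expr (fun x => a * f x)
| SE_add f g : smooth_expr f -> smooth_expr g -> smooth_expr (fun x => f x + g x)
| SE_mul f g : smooth_expr f -> smooth_expr g -> smooth_expr (fun x => f x * g x)
| SE_inv f : smooth_expr f -> (forall x, f x != 0) -> smooth_expr (fun x => (f x)^-1).

Lemma is_derive_affine (a b x : R) : is_derive x 1 (fun x => a * x + b) a.
Proof.
have : is_derive x 1 ((a \*: id) \+ cst b) (a *: 1 + 0) by exact: is_deriveD.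
move=> h; apply: (is_derive_eqfun _ _ _ _ _ h) => // ; by rewrite addr0 scaleRE mulr1.
Qed.

Lemma smooth_expr_derive f : smooth_expr f ->
  exists2 g, smooth_expr g & forall x, is_derive x 1 f (g x).
Proof.
elim=> {f}.
- move=> p; exists (flat (flat_deriv p)); first exact: SE_flat.
  by move=> x; exact: is_derive_flat.
- move=> f a b _ [g sg dg]; exists (fun x => a * g (a * x + b)).
    by apply: SE_scale; exact: SE_affine.
  move=> x; have h := @is_derive1_comp _ f (fun x => a * x + b) _ _ _ (dg _) (is_derive_affine a b x).
  by apply: (is_derive_eqfun _ _ _ _ _ h) => //; rewrite mulrC.
- move=> f a _ [g sg dg]; exists (fun x => a * g x); first exact: SE_scale.
  by move=> x; exact: is_deriveZ.
- move=> f g _ [f' sf df] _ [g' sg dg]; exists (fun x => f' x + g' x).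
    exact: SE_add.
  by move=> x; exact: is_deriveD.
- move=> f g sf [f' sf' df] sg [g' sg' dg]; exists (fun x => f x * g' x + g x * f' x).
    by apply: SE_add; exact: SE_mul.
  by move=> x; exact: is_deriveM.
- move=> f sf [f' sf' df] f0; exists (fun x => -1 * ((f x)^-1 * (f x)^-1 * f' x)).
    by apply/SE_scale/SE_mul => //; apply: SE_mul; exact: SE_inv.
  move=> x; apply: (is_derive_eqfun _ _ _ _ _ (is_deriveV (f0 x) (df x))) => //.
  by rewrite scaleRE expr2 invfM; ring.
Qed.

Lemma smooth_expr_derivable f n x : smooth_expr f -> derivable (f^`(n))%classic x 1.
Proof.
move=> sf; suff [g sg ->] : exists2 g, smooth_expr g & (f^`(n))%classic = g.
  have [g' _ dg] := smooth_expr_derive _ sg; exact: (@ex_derive _ _ _ _ _ _ _ (dg x)).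
elim: n => [|n [g sg IH]]; first by exists f.
have [g' sg' dg] := smooth_expr_derive _ sg; exists g' => //.
rewrite derive1nS IH; apply/funext => z; rewrite derive1E.
exact: (@derive_val _ _ _ _ _ _ _ (dg z)).
Qed.

End smooth_step.

Section step.
Context {R : realType}.
Implicit Types (x : R).

Definition flat1 (x : R) : R := flat 1 x.
Definition dflat1 (x : R) : R := flat (flat_deriv 1) x.

Lemma flat1_ge0 x : 0 <= flat1 x.
Proof. by rewrite /flat1 /flat; case: ifP => // _; rewrite hornerC mul1r expR_ge0. Qed.

Lemma flat1_gt0 x : 0 < x -> 0 < flat1 x.
Proof. by rewrite /flat1 /flat => ->; rewrite hornerC mul1r expR_gt0. Qed.

Lemma dflat1_ge0 x : 0 <= dflat1 x.
Proof.
rewrite /dflat1 /flat; case: ifP => // x0.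
rewrite /flat_deriv derivC subr0 mulr1 hornerXn mulr_ge0 ?expR_ge0//.
exact: sqr_ge0.
Qed.

Lemma flat_le0 (p : {poly R}) x : x <= 0 -> flat p x = 0.
Proof. by rewrite /flat ltNge => ->. Qed.

Definition smoothstep_den x := flat1 x + flat1 (-1 * x + 1).

Lemma smoothstep_den_gt0 x : 0 < smoothstep_den x.
Proof.
rewrite /smoothstep_den; have [x0|x0] := ltP 0 x.
  by rewrite ltr_pwDl ?flat1_gt0 ?flat1_ge0.
by rewrite ltr_wpDl ?flat1_ge0// flat1_gt0//; lra.
Qed.

Definition smoothstep x := flat1 x * (smoothstep_den x)^-1.

Definition dsmoothstep x :=
  (dflat1 x * flat1 (-1 * x + 1) + flat1 x * dflat1 (-1 * x + 1)) / smoothstep_den x ^+ 2.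

Lemma smooth_smoothstep_den : smooth_expr smoothstep_den.
Proof. apply: SE_add; [|apply: SE_affine]; exact: SE_flat. Qed.

Lemma smooth_smoothstep : smooth_expr smoothstep.
Proof.
apply: SE_mul; first exact: SE_flat.
by apply: SE_inv; [exact: smooth_smoothstep_den|move=> x; rewrite gt_eqF ?smoothstep_den_gt0].
Qed.

Lemma is_derive_smoothstep x : is_derive x 1 smoothstep (dsmoothstep x).
Proof.
have d0 := gt_eqF (smoothstep_den_gt0 x).
have d1 : is_derive x 1 flat1 (dflat1 x) by exact: is_derive_flat.
have d2 : is_derive x 1 (fun z => flat1 (-1 * z + 1)) (dflat1 (-1 * x + 1) * -1).
  exact: (@is_derive1_comp _ flat1 (fun z => -1 * z + 1) _ _ _ (is_derive_flat _ _) (is_derive_affine _ _ _)).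
have d3 : is_derive x 1 smoothstep_den (dflat1 x + dflat1 (-1 * x + 1) * -1) by exact: is_deriveD.
have d4 : is_derive x 1 (fun z => (smoothstep_den z)^-1) _ := is_deriveV (negbT d0) d3.
apply: (is_derive_eqfun _ _ _ _ _ (is_deriveM d1 d4)) => //.
rewrite !scaleRE /dsmoothstep.
move: d0; rewrite /smoothstep_den; move: (flat1 x) (flat1 _) (dflat1 x) (dflat1 _) => u v u' v' /negbT d0.
by field.
Qed.

Lemma dsmoothstep_ge0 x : 0 <= dsmoothstep x.
Proof.
by rewrite divr_ge0 ?sqr_ge0// addr_ge0// mulr_ge0 ?flat1_ge0 ?dflat1_ge0.
Qed.

Lemma dsmoothstep_le0 x : x <= 0 -> dsmoothstep x = 0.
Proof. by move=> x0; rewrite /dsmoothstep /dflat1 /flat1 !(flat_le0 _ _ x0) !mul0r addr0 mul0r. Qed.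

Lemma dsmoothstep_ge1 x : 1 <= x -> dsmoothstep x = 0.
Proof.
move=> x1; have x0 : -1 * x + 1 <= 0 by lra.
by rewrite /dsmoothstep /dflat1 /flat1 !(flat_le0 _ _ x0) !mulr0 addr0 mul0r.
Qed.

Lemma smoothstep_le0 x : x <= 0 -> smoothstep x = 0.
Proof. by move=> x0; rewrite /smoothstep /flat1 (flat_le0 _ _ x0) mul0r. Qed.

Lemma smoothstep_ge1 x : 1 <= x -> smoothstep x = 1.
Proof.
move=> x1; have x0 : -1 * x + 1 <= 0 by lra.
rewrite /smoothstep /smoothstep_den [flat1 (-1 * x + 1)](flat_le0 _ _ x0) addr0 divff// gt_eqF// flat1_gt0//; lra.
Qed.

Lemma smoothstep_ge0 x : 0 <= smoothstep x.
Proof. by rewrite mulr_ge0 ?flat1_ge0// invr_ge0 ltW ?smoothstep_den_gt0. Qed.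

Lemma smoothstep_le1 x : smoothstep x <= 1.
Proof. by rewrite ler_pdivrMr ?smoothstep_den_gt0// mul1r lerDl flat1_ge0. Qed.

Lemma continuous_dsmoothstep : continuous dsmoothstep.
Proof.
have [g sg dg] := smooth_expr_derive _ smooth_smoothstep.
have -> : dsmoothstep = g.
  by apply/funext => x; have [_ <-] := dg x; have [_ <-] := is_derive_smoothstep x.
have [g' _ dg'] := smooth_expr_derive _ sg.
move=> x; apply: differentiable_continuous; apply/derivable1_diffP.
exact: (@ex_derive _ _ _ _ _ _ _ (dg' x)).
Qed.

End step.
(** * Hoelder continuity of the convolution with a square integrable kernel *)

Section holder.
Context {R : realType}.
Notation mu := (@lebesgue_measure R).
Implicit Types (f g Y : R -> R) (t h : R).

Lemma Lnorm2_sqr f : (Lnorm mu 2%:E (EFin \o f) ^+ 2 = \int[mu]_x (f x ^+ 2)%:E)%E.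
Proof.
have -> : forall x : \bar R, (0 <= x -> x ^+ 2 = x `^ 2)%E.
- move=> [r r0| _|//]; first by rewrite poweR_EFin (powR_mulrn 2).
  by rewrite poweRyr.
- rewrite poweR_Lnorm//; apply: eq_integral => x _.
by rewrite /= (powR_mulrn 2)// real_normK ?num_real.
- exact: Lnorm_ge0.
Qed.

Lemma cauchy_schwarz f g : measurable_fun setT f -> measurable_fun setT g ->
  ((\int[mu]_x `|f x * g x|%:E) ^+ 2 <=
   (\int[mu]_x (f x ^+ 2)%:E) * \int[mu]_x (g x ^+ 2)%:E)%E.
Proof.
move=> mf mg.
have h : (2^-1 + 2^-1 = 1 :> R) by lra.
have := @hoelder _ _ _ mu f g 2 2 mf mg (ltr0n _ 2) (ltr0n _ 2) h.
rewrite Lnorm1 => H.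
rewrite -!Lnorm2_sqr !expe2 muleACA; apply: lee_pmul => //; exact: integral_ge0.
Qed.

Lemma abel_sqr (a : R) x : abel a x ^+ 2 = abel (2 * a - 1) x.
Proof.
rewrite /abel; case: ifPn => x0; last by rewrite expr0n.
by rewrite expr2 -powRD ?(lt0r_neq0 x0) ?implybT//; congr (_ `^ _); ring.
Qed.

Lemma abel_nincr (a x y : R) : a <= 1 -> 0 < x -> x <= y -> abel a y <= abel a x.
Proof.
move=> a1 x0 xy; have y0 : 0 < y by lra.
rewrite !abel_gt0E// -(opprB 1 a) !powRN lef_pV2 ?posrE ?powR_gt0//.
by apply: ge0_ler_powR => //; rewrite ?nnegrE; lra.
Qed.

Lemma abel_ndecr (a x y : R) : 1 <= a -> x <= y -> abel a x <= abel a y.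
Proof.
move=> a1 xy; have [x0|x0] := leP x 0; first by rewrite (abel_le0E _ _ x0) abel_ge0.
rewrite !abel_gt0E//; last by lra.
by apply: ge0_ler_powR => //; rewrite ?nnegrE; lra.
Qed.

Lemma measurable_abel_subl (a c : R) : measurable_fun setT (fun x : R => abel a (c - x)).
Proof. exact: (measurable_subl c (abel a) (measurable_abel a)). Qed.

Lemma measurable_abel_subr (a c : R) : measurable_fun setT (fun x : R => abel a (x - c)).
Proof. by apply: (measurableT_comp (measurable_abel a)); exact: measurable_funB. Qed.

Lemma integral_abel_from (a c d : R) : 0 < a ->
  (\int[mu]_x (abel a (d - x) * abel 1 (x - c))%:E = (abel (a + 1) (d - c) / a)%:E)%E.
Proof.
move=> a0; rewrite kconv_shift ?kconv_abel1r//; try exact: measurable_abel;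
  move=> z; exact: abel_ge0.
Qed.

(** This is [(p - q)^2 <= |p^2 - q^2|] for [p, q >= 0], in a form where every term is
nonnegative and has an explicit integral; squares of Abel kernels are again Abel
kernels ([abel_sqr]). *)
Lemma abel_diff_sqr (a t h s : R) : 1 / 2 < a -> a <= 1 -> 0 <= h -> s != t ->
  (abel a (t + h - s) - abel a (t - s)) ^+ 2 + abel (2 * a - 1) (t + h - s) <=
  abel (2 * a - 1) (t - s) + 2 * (abel (2 * a - 1) (t + h - s) * abel 1 (s - t)).
Proof.
move=> a1 a2 h0 st; rewrite -!abel_sqr abel1E.
have [ts|ts] := ltP t s.
  rewrite subr_gt0 ts (@abel_le0E _ a (t - s)); last by lra.
  by rewrite expr0n /= subr0 add0r mulr1 mulr2n mulrDl mul1r.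
have {st}ts : s < t by rewrite lt_neqAle st ts.
rewrite subr_gt0 ltNge (ltW ts) /= !mulr0 addr0.
have := @abel_nincr a (t - s) (t + h - s) a2.
have := abel_ge0 a (t + h - s).
move: (abel a (t + h - s)) (abel a (t - s)) => u v u0 uv.
have {}uv : u <= v by apply: uv; lra.
nra.
Qed.

Lemma sqr_lty (x : \bar R) : (x ^+ 2 < +oo -> x < +oo)%E.
Proof. by case: x => [r _| |//]; rewrite ?ltry// expe2 mulyy ltxx. Qed.

Lemma conv_abel_integrable (a t : R) Y : 1 / 2 < a -> measurable_fun setT Y ->
  (forall s, s <= 0 -> Y s = 0) -> (\int[mu]_x (Y x ^+ 2)%:E < +oo)%E ->
  mu.-integrable setT (fun s => (abel a (t - s) * Y s)%:E).
Proof.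
move=> a1 mY Y0 Yfin.
have mK : measurable_fun setT (fun s : R => abel a (t - s) * abel 1 (s - 0)).
  apply: measurable_funM; first exact: measurable_abel_subl.
  exact: measurable_abel_subr.
have KY s : abel a (t - s) * Y s = (abel a (t - s) * abel 1 (s - 0)) * Y s.
  rewrite abel1E subr0; case: ltP => s0; rewrite ?mulr1//.
  by rewrite Y0// !mulr0.
apply/integrableP; split.
  by apply/measurable_EFinP; under eq_fun do rewrite KY; exact: measurable_funM.
have H := cauchy_schwarz _ _ mK mY.
have : ((\int[mu]_x (`|abel a (t - x) * abel 1 (x - 0) * Y x|)%:E) ^+ 2 < +oo)%E.
  apply: (le_lt_trans H).
  have -> : (\int[mu]_x ((abel a (t - x) * abel 1 (x - 0)) ^+ 2)%:E =
     \int[mu]_x (abel (2 * a - 1) (t - x) * abel 1 (x - 0))%:E)%E.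
    apply: eq_integral => x _; rewrite exprMn abel_sqr; congr (_ * _)%:E.
    by rewrite abel1E -natrX; case: (_ < _).
  rewrite integral_abel_from; last by lra.
  apply: lte_mul_pinfty => //; rewrite lee_fin divr_ge0 ?abel_ge0//; lra.
have -> : (\int[mu]_x `|(abel a (t - x) * Y x)%:E| =
  \int[mu]_x (`|abel a (t - x) * abel 1 (x - 0) * Y x|)%:E)%E.
  by apply: eq_integral => x _; rewrite -KY.
exact: sqr_lty.
Qed.

Lemma conv_abel_holder (a t h : R) Y : 1 / 2 < a -> a <= 1 -> measurable_fun setT Y ->
  (forall s, s <= 0 -> Y s = 0) -> (\int[mu]_x (Y x ^+ 2)%:E < +oo)%E -> 0 <= h ->
  (conv (abel a) Y (t + h) - conv (abel a) Y t) ^+ 2 <=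
  2 * (abel (2 * a) h / (2 * a - 1)) * fine (\int[mu]_x (Y x ^+ 2)%:E)%E.
Proof.
move=> a1 a2 mY Y0 Yfin h0.
set g := 2 * a - 1; have g0 : 0 < g by rewrite /g; lra.
have g1E : 2 * a = g + 1 by rewrite /g; ring.
pose D s := (abel a (t + h - s) - abel a (t - s)) * abel 1 (s - 0).
have mD : measurable_fun setT D.
  apply: measurable_funM; last exact: measurable_abel_subr.
  by apply: measurable_funB; exact: measurable_abel_subl.
have D2 : (\int[mu]_s (D s ^+ 2)%:E <= (2 * (abel (2 * a) h / g))%:E)%E.
  have P0 x : 0 <= abel (g + 1) x / g by rewrite divr_ge0 ?abel_ge0 ?ltW.
  have H : (\int[mu]_s (D s ^+ 2)%:E + (abel (g + 1) (t + h - 0) / g)%:E <=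
    (abel (g + 1) (t - 0) / g)%:E + 2%:E * (abel (g + 1) (t + h - t) / g)%:E)%E.
    have mk c d : measurable_fun setT (fun x : R => (abel g (d - x) * abel 1 (x - c))%:E).
      apply/measurable_EFinP; apply: measurable_funM; first exact: measurable_abel_subl.
      exact: measurable_abel_subr.
    have k0 c d x : (0 <= (abel g (d - x) * abel 1 (x - c))%:E)%E.
      by rewrite lee_fin mulr_ge0 ?abel_ge0.
    have mD2 : measurable_fun setT (fun s => (D s ^+ 2)%:E).
      by apply/measurable_EFinP; exact: measurable_funX.
    have D20 s : (0 <= (D s ^+ 2)%:E)%E by rewrite lee_fin sqr_ge0.
    rewrite -!integral_abel_from// -ge0_integralZl//=; last exact: mk.
    have mk2 := measurable_funeM 2%:E (mk t (t + h)).
    rewrite -!ge0_integralD//=; try exact: mk; try (by move=> x _; rewrite mule_ge0).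
    apply: ae_ge0_le_integral => //=.
    - by move=> x _; rewrite adde_ge0.
    - by apply: emeasurable_funD; try exact: mk.
    - by move=> x _; rewrite adde_ge0// mule_ge0.
    - by apply: emeasurable_funD; try exact: mk.
    (* the pointwise inequality fails at the single point [s = t] *)
    exists [set t]; split => //; first by rewrite lebesgue_measure_set1.
    move=> s /=; apply: contra_notP => /eqP st _.
    rewrite -EFinM -!EFinD lee_fin /D.
    have := abel_diff_sqr a t h s a1 a2 h0 st; rewrite -/g subr0 (abel1E s).
    case: ltP => s0; rewrite ?mulr1//.
    rewrite !mulr0 expr0n /= !add0r => _; by rewrite mulr_ge0// mulr_ge0 ?abel_ge0.
  rewrite subr0 subr0 (_ : t + h - t = h) in H; last by ring.
  rewrite g1E.
  have Pm : abel (g + 1) t <= abel (g + 1) (t + h) by apply: abel_ndecr; lra.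
  have Pm' : abel (g + 1) t / g <= abel (g + 1) (t + h) / g.
    by rewrite ler_pM2r ?invr_gt0.
  (* the common term [abel (g + 1) (t + h) / g] is finite and can be cancelled *)
  move: H; case: (integral _ _ _) => [r| |] //=; last by move=> _; exact: leNye.
  rewrite -EFinM -!EFinD !lee_fin; lra.
have iK := conv_abel_integrable a _ Y a1 mY Y0 Yfin.
have EB := RintegralB measurableT (iK (t + h)) (iK t).
rewrite -[X in X ^+ 2]EB.
have DY : \int[mu]_s (abel a (t + h - s) * Y s - abel a (t - s) * Y s) = \int[mu]_s (D s * Y s).
  apply: eq_Rintegral => s _; rewrite /D abel1E subr0; case: ltP => s0.
    by rewrite mulr1 mulrBl.
  by rewrite Y0// !mulr0 subr0.
rewrite [X in X ^+ 2]DY.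
have H := cauchy_schwarz _ _ mD mY.
have Y20 : (0 <= \int[mu]_x (Y x ^+ 2)%:E)%E by apply: integral_ge0 => x _; rewrite lee_fin sqr_ge0.
have {}H : ((\int[mu]_x (`|D x * Y x|)%:E) ^+ 2 <= (2 * (abel (2 * a) h / g) * fine (\int[mu]_x (Y x ^+ 2)%:E)%E)%:E)%E.
  apply: (le_trans H); rewrite EFinM fineK ?ge0_fin_numE//.
  exact: lee_wpmul2r.
have iDY : mu.-integrable setT (fun s => (D s * Y s)%:E).
  have := integrableB measurableT (iK (t + h)) (iK t).
  apply: eq_integrable => // s _ /=; rewrite -EFinB /D abel1E subr0; case: ltP => s0.
    by rewrite mulr1 mulrBl.
  by rewrite Y0// !mulr0 subr0.
have N := le_normr_Rintegral measurableT iDY.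
rewrite -lee_fin; apply: le_trans H.
rewrite -real_normK ?num_real//.
have Ifin : (\int[mu]_x (`|D x * Y x|)%:E)%E \is a fin_num.
  by apply: integrable_fin_num => //; exact: integrable_norm iDY.
rewrite -(fineK Ifin) -EFin_expe lee_fin.
by rewrite ler_sqr ?nnegrE// Rintegral_ge0.
Qed.

Lemma conv_abel_continuous (a : R) Y : 1 / 2 < a -> a <= 1 -> measurable_fun setT Y ->
  (forall s, s <= 0 -> Y s = 0) -> (\int[mu]_x (Y x ^+ 2)%:E < +oo)%E ->
  continuous (conv (abel a) Y).
Proof.
move=> a1 a2 mY Y0 Yfin t.
set N := fine (\int[mu]_x (Y x ^+ 2)%:E)%E.
have N0 : 0 <= N by apply: fine_ge0; apply: integral_ge0 => x _; rewrite lee_fin sqr_ge0.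
pose c := 2 / (2 * a - 1) * N + 1.
have c0 : 0 < c by rewrite /c ltr_wpDl// mulr_ge0// divr_ge0//; lra.
have hold x y : (conv (abel a) Y x - conv (abel a) Y y) ^+ 2 <= c * abel (2 * a) `|x - y|.
  wlog xy : x y / y <= x.
    move=> W; have [/W//|/ltW/W] := leP y x.
    by move=> h; rewrite -[X in X ^+ 2]opprB sqrrN distrC.
  rewrite ger0_norm ?subr_ge0// -{1}(subrK y x) [X in conv _ _ X]addrC.
  apply: le_trans (conv_abel_holder a y (x - y) Y a1 a2 mY Y0 Yfin _) _; first by rewrite subr_ge0.
  rewrite -/N /c [leRHS]mulrDl mul1r.
  have := abel_ge0 (2 * a) (x - y); move: (abel _ _) => k k0.
  rewrite (_ : 2 * _ * N = 2 / (2 * a - 1) * N * k) ?lerDl//; ring.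
apply/cvgrPdist_le => e e0.
have e20 : 0 < e ^+ 2 / c by rewrite divr_gt0// exprn_gt0.
near=> x.
rewrite -ler_sqr ?nnegrE ?normr_ge0 ?(ltW e0)// real_normK ?num_real//.
apply: le_trans (hold _ _) _.
rewrite -ler_pdivlMl// [leRHS]mulrC.
have [->|xt] := eqVneq x t; first by rewrite subrr normr0 abel_le0E// ltW.
rewrite abel_gt0E ?normr_gt0 ?subr_eq0 1?eq_sym//.
have g0 : 0 < 2 * a - 1 by lra.
have -> : e ^+ 2 / c = ((e ^+ 2 / c) `^ (2 * a - 1)^-1) `^ (2 * a - 1).
  by rewrite -powRrM mulVf ?lt0r_neq0// powRr1 ?(ltW e20).
apply: ge0_ler_powR; [exact: ltW|by rewrite nnegrE|by rewrite nnegrE powR_ge0|].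
(* the radius [r] solves [c * r ^ (2 * a - 1) = e ^ 2] *)
near: x; apply/nbhs_ballP; exists ((e ^+ 2 / c) `^ (2 * a - 1)^-1) => /=.
  exact: powR_gt0.
by move=> z /ltW.
Unshelve. all: by end_near. Qed.

End holder.
(** * From a weak derivative to a primitive *)

Section weak.
Context {R : realType}.
Notation mu := (@lebesgue_measure R).
Implicit Types (c e x : R).

Definition rise c e x : R := smoothstep (e^-1 * x + - (c / e)).
Definition drise c e x : R := e^-1 * dsmoothstep (e^-1 * x + - (c / e)).

Lemma rise_argE c e x : e^-1 * x + - (c / e) = (x - c) / e.
Proof. by rewrite mulrBl mulrC. Qed.

Lemma smooth_rise c e : smooth_expr (rise c e).
Proof. apply: (SE_affine _ _ _ smooth_smoothstep). Qed.

Lemma is_derive_rise c e x : is_derive x 1 (rise c e) (drise c e x).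
Proof.
have h := @is_derive1_comp _ (@smoothstep R) (fun x => e^-1 * x + - (c / e)) _ _ _
  (is_derive_smoothstep _) (is_derive_affine _ _ x).
by apply: (is_derive_eqfun _ _ _ _ _ h) => //; rewrite mulrC.
Qed.

Lemma rise_le c e x : 0 < e -> x <= c -> rise c e x = 0.
Proof.
by move=> e0 xc; rewrite /rise rise_argE smoothstep_le0// ler_pdivrMr// mul0r subr_le0.
Qed.

Lemma rise_ge c e x : 0 < e -> c + e <= x -> rise c e x = 1.
Proof.
move=> e0 xc; rewrite /rise rise_argE smoothstep_ge1// ler_pdivlMr// mul1r; lra.
Qed.

Lemma drise_ge0 c e x : 0 < e -> 0 <= drise c e x.
Proof. by move=> e0; rewrite mulr_ge0 ?dsmoothstep_ge0// invr_ge0 ltW. Qed.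

Lemma drise_out c e x : 0 < e -> x \notin `[c, c + e] -> drise c e x = 0.
Proof.
move=> e0; rewrite in_itv/= negb_and -!ltNge /drise rise_argE => /orP[h|h].
- by rewrite dsmoothstep_le0 ?mulr0// ler_pdivrMr// mul0r subr_le0 ltW.
- by rewrite dsmoothstep_ge1 ?mulr0// ler_pdivlMr// mul1r; lra.
Qed.

Lemma continuous_drise c e : continuous (drise c e).
Proof.
move=> x; apply: cvgMr.
have h : continuous (fun z : R => e^-1 * z + - (c / e)).
  by move=> z; apply: cvgD; [apply: cvgMr; exact: cvg_id|exact: cvg_cst].
by apply: (continuous_comp (h x)); exact: continuous_dsmoothstep.
Qed.

Lemma integral_drise c e : 0 < e ->
  (\int[mu]_(x in `[c, (c + e)%R]) (drise c e x)%:E = 1)%E.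
Proof.
move=> e0.
have cr x : {for x, continuous (rise c e)}.
  apply: differentiable_continuous; apply/derivable1_diffP.
  exact: (@ex_derive _ _ _ _ _ _ _ (is_derive_rise c e x)).
rewrite (@continuous_FTC2 _ _ (rise c e)).
- by rewrite rise_ge// rise_le// sube0.
- lra.
- by apply: continuous_subspaceT; exact: continuous_drise.
- split.
  + move=> x _; exact: (@ex_derive _ _ _ _ _ _ _ (is_derive_rise c e x)).
  + by apply: cvg_at_right_filter; apply: cr.
  + by apply: cvg_at_left_filter; apply: cr.
- move=> x _; rewrite derive1E.
  exact: (@derive_val _ _ _ _ _ _ _ (is_derive_rise c e x)).
Qed.

(** The functions [drise c e] are nonnegative, of integral [1] and concentrated on
[[c, c + e]]. *)
Lemma mollify (u : R -> R) (T c e v d : R) : continuous u -> 0 < e -> 0 < c -> c + e < T ->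
  (forall x, c <= x <= c + e -> `|u x - v| <= d) ->
  `|\int[mu]_(x in `]0, T[) (u x * drise c e x) - v| <= d.
Proof.
move=> cu e0 c0 ceT H.
have -> : \int[mu]_(x in `]0, T[) (u x * drise c e x) =
          \int[mu]_(x in `[c, c + e]) (u x * drise c e x).
  rewrite Rintegral_mkcond [RHS]Rintegral_mkcond; apply: eq_Rintegral => x _.
  rewrite !patchE !mem_setE; case: (boolP (x \in `[c, c + e])) => xc.
    by rewrite ifT//; move: xc; rewrite !in_itv/= => /andP[? ?]; lra.
  by rewrite drise_out// mulr0; case: ifP.
have ic (f : R -> R) : continuous f -> mu.-integrable `[c, c + e] (EFin \o f).
  move=> cf; apply: continuous_compact_integrable; first exact: segment_compact.
  exact: continuous_subspaceT.
have cd := continuous_drise c e.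
have iu : mu.-integrable `[c, c + e] (EFin \o (fun x => u x * drise c e x)).
  by apply: ic => x; apply: cvgM; [exact: cu|exact: cd].
have iv k : mu.-integrable `[c, c + e] (EFin \o (fun x => k * drise c e x)).
  by apply: ic => x; apply: cvgMr; exact: cd.
have Ik k : \int[mu]_(x in `[c, c + e]) (k * drise c e x) = k.
  by rewrite RintegralZl//; [rewrite /Rintegral integral_drise// mulr1|exact: ic].
rewrite -{1}(Ik v) -RintegralB//.
have id : mu.-integrable `[c, c + e] (EFin \o (fun x => u x * drise c e x - v * drise c e x)).
  by apply: ic => x; apply: cvgB; [apply: cvgM; [exact: cu|exact: cd]|apply: cvgMr; exact: cd].
apply: (le_trans (le_normr_Rintegral _ id)) => //.
rewrite -[leRHS](Ik d); apply: le_Rintegral => //.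
- exact: integrable_norm id.
- move=> x; rewrite /= in_itv/= => xc.
  by rewrite -mulrBl normrM (ger0_norm (drise_ge0 _ _ _ e0)) ler_wpM2r ?drise_ge0// H.
Qed.

Definition plateau (a b e x : R) := rise a e x + (-1) * rise b e x.

Lemma plateau_test (a b e t : R) : 0 < e -> 0 < a -> a <= b -> b + e < t ->
  test_fun t (plateau a b e).
Proof.
move=> e0 a0 ab bt.
have sub : closure [set x | plateau a b e x != 0] `<=` `[a, b + e].
  have /closure_id -> : closed `[a, b + e]%classic by exact: itv_closed.
  apply: closure_subset => x /=; rewrite in_itv/= /plateau.
  apply: contraNT; rewrite negb_and -!ltNge => /orP[h|h].
  - by rewrite !rise_le ?mulr0 ?addr0//; lra.
  - by rewrite !rise_ge ?mulr1 ?subrr//; lra.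
split.
- move=> n x; apply: smooth_expr_derivable.
  by apply: SE_add; [|apply: SE_scale]; exact: smooth_rise.
- apply: subclosed_compact sub; [exact: closed_closure|exact: segment_compact].
- apply: (subset_trans sub) => x /=; rewrite !in_itv/=; lra.
Qed.

Lemma derive_plateau a b e x :
  (plateau a b e)^`()%classic x = drise a e x - drise b e x.
Proof.
rewrite derive1E.
have h2 : is_derive x 1 (fun x => -1 * rise b e x) (-1 * drise b e x).
  by apply: is_deriveZ; exact: is_derive_rise.
have h := is_deriveD (is_derive_rise a e x) h2.
by rewrite (@derive_val _ _ _ _ _ _ _ h) mulN1r.
Qed.

Lemma plateau_bound a b e x : `|plateau a b e x| <= 1.
Proof.
rewrite /plateau /rise.
have := smoothstep_ge0 (e^-1 * x + - (a / e)); have := smoothstep_le1 (e^-1 * x + - (a / e)).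
have := smoothstep_ge0 (e^-1 * x + - (b / e)); have := smoothstep_le1 (e^-1 * x + - (b / e)).
rewrite ler_norml; lra.
Qed.

Lemma measurable_plateau a b e : measurable_fun setT (plateau a b e).
Proof.
apply: continuous_measurable_fun => x.
have h2 : is_derive x 1 (fun x => -1 * rise b e x) (-1 * drise b e x).
  by apply: is_deriveZ; exact: is_derive_rise.
have h := is_deriveD (is_derive_rise a e x) h2.
apply: differentiable_continuous; apply/derivable1_diffP.
exact: (@ex_derive _ _ _ _ _ _ _ h).
Qed.

(** The plateaus [plateau e b e] tend to the indicator of []0, b]] as [e] tends to [0],
while minus the integral of [u] against their derivative tends to [u b - u 0]. *)
Lemma weak_deriv_primitive (T t b : R) (u w : R -> R) : t <= T -> 0 < b -> b < t ->
  continuous u -> mu.-integrable `]0, t[ (EFin \o w) ->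
  dist_represents t (dist_deriv T u) w ->
  u b - u 0 = \int[mu]_(x in `]0, b]) w x.
Proof.
move=> tT b0 bt cu iw rep.
(* small enough for the supports of all plateaus to stay inside []0, t[] *)
pose d0 := Num.min (b / 2) ((t - b) / 3).
have d00 : 0 < d0 by rewrite lt_min; apply/andP; split; lra.
pose e n := d0 * n.+1%:R^-1 : R.
have e0 n : 0 < e n by rewrite mulr_gt0// invr_gt0 ltr0n.
have ed n : e n <= d0 by rewrite ler_piMr ?(ltW d00)// invf_le1 ?ler1n ?ltr0n.
have db : d0 <= b / 2 by rewrite ge_min lexx.
have dt : d0 <= (t - b) / 3 by rewrite ge_min lexx orbT.
have ecv : e n @[n --> \oo] --> 0.
  by rewrite -(mulr0 d0); apply: cvgMr; exact: cvg_harmonic.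
pose phi n := plateau (e n) b (e n).
have tphi n : test_fun t (phi n).
  by apply: plateau_test => //; have := e0 n; have := ed n; lra.
have L1 : \int[mu]_(x in `]0, T[) (u x * drise b (e n) x) @[n --> \oo] --> u b.
  apply/cvgrPdist_le => d dp.
  have /cvgrPdist_le/(_ _ dp)/nbhs_ballP[r /= r0 hr] := cu b.
  have /cvgrPdist_lt/(_ _ r0) := ecv; apply: filterS => n.
  rewrite sub0r normrN gtr0_norm// => er.
  rewrite distrC; apply: mollify => //; first by have := ed n; lra.
  move=> x /andP[x1 x2]; rewrite distrC; apply: hr.
  by rewrite /ball/= ler0_norm ?subr_le0//; lra.
have L0 : \int[mu]_(x in `]0, T[) (u x * drise (e n) (e n) x) @[n --> \oo] --> u 0.
  apply/cvgrPdist_le => d dp.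
  have /cvgrPdist_le/(_ _ dp)/nbhs_ballP[r /= r0 hr] := cu 0.
  have r20 : 0 < r / 2 by lra.
  have /cvgrPdist_lt/(_ _ r20) := ecv; apply: filterS => n.
  rewrite sub0r normrN gtr0_norm// => er.
  rewrite distrC; apply: mollify => //; first by have := ed n; lra.
  move=> x /andP[x1 x2]; rewrite distrC; apply: hr.
  by rewrite /ball/= ler0_norm ?subr_le0//; have := e0 n; lra.
have iuT c n : mu.-integrable `]0, T[ (EFin \o (fun x => u x * drise c (e n) x)).
  apply: (@integrableS _ _ _ mu `[0, T]) => //; first exact: subset_itv_oo_cc.
  apply: continuous_compact_integrable; first exact: segment_compact.
  by apply: continuous_subspaceT => x; apply: cvgM; [exact: cu|exact: continuous_drise].
have LE n : \int[mu]_(x in `]0, T[) (u x * drise b (e n) x) -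
             \int[mu]_(x in `]0, T[) (u x * drise (e n) (e n) x) =
             \int[mu]_(x in `]0, t[) (w x * phi n x).
  rewrite -rep// /dist_deriv -[LHS]opprB; congr (- _).
  rewrite -RintegralB//; apply: eq_Rintegral => x _.
  by rewrite derive_plateau mulrBr.
have L2 : \int[mu]_(x in `]0, t[) (w x * phi n x) @[n --> \oo] -->
          \int[mu]_(x in `]0, b]) w x.
  pose chi x : R := if x <= b then 1 else 0.
  have -> : \int[mu]_(x in `]0, b]) w x = \int[mu]_(x in `]0, t[) (w x * chi x).
    rewrite Rintegral_mkcond [RHS]Rintegral_mkcond; apply: eq_Rintegral => x _.
    rewrite !patchE !mem_setE /chi !in_itv/=.
    have [x0|//] := ltP 0 x; have [xb|xb] := leP x b; last by rewrite mulr0; case: ifP.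
    by rewrite ifT ?mulr1//=; lra.
  have [] := @dominated_convergence _ _ R mu `]0, t[%classic (measurable_itv _)
    (fun n x => (w x * phi n x)%:E) (fun x => (w x * chi x)%:E) (fun x => `|w x|%:E).
  - move=> n; apply/measurable_EFinP; apply: measurable_funM.
      by apply/measurable_EFinP; exact: measurable_int iw.
    by apply: measurable_funTS; exact: measurable_plateau.
  - apply/measurable_EFinP; apply: measurable_funM.
      by apply/measurable_EFinP; exact: measurable_int iw.
    apply: measurable_funTS; apply: measurable_fun_ifT => //.
    exact: measurable_fun_ler.
  - apply: aeW => x; rewrite /= in_itv/= => /andP[x0 xt].
    apply: cvg_EFin; first by apply: nearW.
    apply: cvgMr; apply: cvg_near_cst.
    have r0 : 0 < (if x <= b then x / 2 else Num.min (x / 2) (x - b)).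
      by case: ifPn; rewrite ?lt_min -?ltNge => h; [lra|apply/andP; split; lra].
    have /cvgrPdist_lt/(_ _ r0) := ecv; apply: filterS => n.
    rewrite sub0r normrN gtr0_norm// /phi /plateau /chi.
    case: ifPn; rewrite -?ltNge => xb; rewrite ?lt_min => er.
      by rewrite (rise_le b)// rise_ge ?mulr0 ?addr0//; lra.
    by move: er => /andP[e1 e2]; rewrite !rise_ge// ?mulr1 ?subrr//; lra.
  - exact: integrable_norm iw.
  - apply: aeW => x n _; rewrite /= lee_fin normrM ler_piMr//.
    exact: plateau_bound.
  move=> ichi _ cv.
  apply: fine_cvg; rewrite fineK//.
  exact: integrable_fin_num ichi.
have := cvgB L1 L0.
have -> : ((fun n => \int[mu]_(x in `]0, T[) (u x * drise b (e n) x)) -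
   (fun n => \int[mu]_(x in `]0, T[) (u x * drise (e n) (e n) x))) = (fun n => \int[mu]_(x in `]0, t[) (w x * phi n x)).
  by apply/funext => n; exact: LE.
move=> /(_ _) h; rewrite -(cvg_lim _ L2)//; apply/esym/cvg_lim => //; exact: h.
Qed.

End weak.
(** * The weighted estimate and the Gronwall argument *)

Section estimates.
Context {R : realType}.
Notation mu := (@lebesgue_measure R).
Implicit Types (t s : R).

(** By Lebesgue's differentiation theorem [h] is almost everywhere the derivative of
its primitive. *)
Lemma zero_primitive_ae (h : R -> R) t : mu.-integrable `]0, t[ (EFin \o h) ->
  (forall b, 0 < b < t -> \int[mu]_(x in `]0, b]) h x = 0) ->
  {ae mu, forall x, x \in `]0, t[ -> h x = 0}.
Proof.
move=> ih h0.
pose H := h \_ `]0, t[.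
have iH : mu.-integrable setT (EFin \o H).
  have -> : EFin \o H = (EFin \o h) \_ `]0, t[.
    by apply/funext => x; rewrite /= /H !patchE; case: ifP.
  exact/(integrable_mkcond _ _).1.
have iHS D : measurable D -> mu.-integrable D (EFin \o H).
  by move=> mD; apply: integrableS iH.
have locH : locally_integrable [set: R] H by exact: integrable_locally.
have H0 x : x < t -> \int[mu]_(z in `]-oo, x]) H z = 0.
  move=> xt; have [x0|x0] := leP x 0.
    rewrite (@eq_Rintegral _ _ _ _ _ (fun=> 0)); first by rewrite Rintegral_cst// mul0r.
    move=> z; rewrite inE/= in_itv/= => zx; rewrite /H patchE mem_setE in_itv/= ifF//.
    by apply/negP => /andP[]; lra.
  rewrite -[RHS](h0 x) ?x0//.
  rewrite Rintegral_mkcond [RHS]Rintegral_mkcond; apply: eq_Rintegral => z _.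
  rewrite !patchE !mem_setE !in_itv/= /H patchE mem_setE in_itv/=.
  have [z0|z0] /= := ltP 0 z; last by case: ifP.
  by have [zx|//] := leP z x; rewrite ifT//; lra.
have := FTC1Ny (fun y => iHS _ (measurable_itv _)) locH.
apply: filterS; first exact: (ae_filter_ringOfSetsType mu).
move=> x [_ dx] xt; move: (xt); rewrite in_itv/= => /andP[x0 xt'].
have <- : H x = h x by rewrite /H patchE mem_setE xt.
rewrite -dx derive1E -[RHS](derive_cst (0 : R) x 1).
apply: near_eq_derive; near=> z; apply: H0.
near: z; exact: lt_nbhsl.
Unshelve. all: by end_near. Qed.

(** Cauchy-Schwarz for the measure with density [abel b (s - r)]. *)
Lemma conv_abel_sqr (b s : R) (W : R -> R) : 0 < b -> measurable_fun setT W ->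
  (forall r, r <= 0 -> W r = 0) ->
  ((conv (abel b) W s ^+ 2)%:E <= (abel (b + 1) s / b)%:E *
     \int[mu]_r (abel b (s - r) * W r ^+ 2)%:E)%E.
Proof.
move=> b0 mW W0.
(* [c] is chosen so that the square of [abel c] is [abel b] *)
pose c := (b + 1) / 2.
have cE : 2 * c - 1 = b by rewrite /c; field.
have mf : measurable_fun setT (fun r : R => abel c (s - r) * abel 1 (r - 0)).
  by apply: measurable_funM; [exact: measurable_abel_subl|exact: measurable_abel_subr].
have mg : measurable_fun setT (fun r : R => abel c (s - r) * W r).
  by apply: measurable_funM => //; exact: measurable_abel_subl.
have := cauchy_schwarz _ _ mf mg.
have -> : (\int[mu]_x ((abel c (s - x) * abel 1 (x - 0)) ^+ 2)%:E = (abel (b + 1) s / b)%:E)%E.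
  have := @integral_abel_from R b 0 s b0; rewrite subr0 => <-; apply: eq_integral => x _.
  by rewrite exprMn !abel_sqr cE; congr (_ * abel _ _)%:E; ring.
have -> : (\int[mu]_x ((abel c (s - x) * W x) ^+ 2)%:E = \int[mu]_r (abel b (s - r) * W r ^+ 2)%:E)%E.
  by apply: eq_integral => x _; rewrite exprMn abel_sqr cE.
apply: le_trans.
have -> : (\int[mu]_x (`|abel c (s - x) * abel 1 (x - 0) * (abel c (s - x) * W x)|)%:E =
           \int[mu]_x `|(abel b (s - x) * W x)%:E|)%E.
  apply: eq_integral => x _; rewrite abse_EFin; congr (`|_|)%:E.
  rewrite -cE -abel_sqr (abel1E (x - 0)) subr0; case: ltP => x0; first by rewrite /=; ring.
  by rewrite W0// !mulr0.
have mk : measurable_fun setT (fun x : R => (abel b (s - x) * W x)%:E).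
  by apply/measurable_EFinP; apply: measurable_funM => //; exact: measurable_abel_subl.
have [fin|] := ltP (\int[mu]_x `|(abel b (s - x) * W x)%:E|)%E +oo%E; last first.
  by rewrite leye_eq => /eqP ->; rewrite expe2 mulyy leey.
have ik : mu.-integrable setT (fun x => (abel b (s - x) * W x)%:E) by apply/integrableP.
have N := le_normr_Rintegral measurableT ik.
have I0 : (0 <= \int[mu]_x `|(abel b (s - x) * W x)%:E|)%E by apply: integral_ge0.
have Ifin : (\int[mu]_x `|(abel b (s - x) * W x)%:E|)%E \is a fin_num by rewrite ge0_fin_numE.
rewrite -(fineK Ifin) -EFin_expe lee_fin -(real_normK (num_real (conv _ _ _))).
by rewrite ler_sqr ?nnegrE ?fine_ge0//; exact: N.
Qed.

(** The truncation at [s] is expressed by the Heaviside kernel, as in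
[restrict_abel1] and [integral_conv_sqr]. *)
Definition energy (W : R -> R) s : R := fine (\int[mu]_r (abel 1 (s - r) * W r ^+ 2)%:E)%E.

Lemma integral_conv_sqr (b t T : R) (W : R -> R) : 0 < b -> t <= T -> measurable_fun setT W ->
  (forall r, r <= 0 -> W r = 0) ->
  (\int[mu]_(s in `]0%R, t[) (conv (abel b) W s ^+ 2)%:E <=
   (abel (b + 1) T / b)%:E * \int[mu]_r (abel (b + 1) (t - r) / b * W r ^+ 2)%:E)%E.
Proof.
move=> b0 tT mW W0.
have mW2 : measurable_fun setT (fun r : R => W r ^+ 2) by exact: measurable_funX.
have k0 (a x : R) : 0 <= abel a x := abel_ge0 a x.
have mk (a : R) : measurable_fun setT (abel a) := measurable_abel a.
rewrite -(@kconv_tonelli _ (abel 1) (abel b) _ (fun x => abel (b + 1) x / b))//; last 2 first.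
- by move=> z; exact: sqr_ge0.
- by move=> z; exact: kconv_abel1l.
have I0 x : (0 <= \int[mu]_s (abel b (x - s) * W s ^+ 2)%:E)%E.
  by apply: integral_ge0 => r _; rewrite lee_fin mulr_ge0 ?sqr_ge0.
have mI : measurable_fun setT (fun x : R => \int[mu]_s (abel b (x - s) * W s ^+ 2)%:E)%E.
  apply: (measurable_fubini (fun p : R * R => (abel b (p.1 - p.2) * W p.2 ^+ 2)%:E)).
  apply/measurable_EFinP.
  exact: (@measurable_convand R (abel b) (fun r => W r ^+ 2)).
have mt : measurable_fun setT (fun x : R => (abel 1 (t - x))%:E * \int[mu]_s (abel b (x - s) * W s ^+ 2)%:E)%E.
  apply: emeasurable_funM => //; apply/measurable_EFinP; exact: measurable_abel_subl.
rewrite -ge0_integralZl//; last 2 first.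
- by move=> x _; rewrite mule_ge0// lee_fin.
- by rewrite lee_fin divr_ge0// ltW.
rewrite [leLHS]integral_mkcond; apply: ge0_le_integral => //.
- by move=> x _; rewrite patchE; case: ifP => // _; rewrite lee_fin sqr_ge0.
- apply/(measurable_restrictT _ _).1 => //; apply: measurable_funTS.
  by apply/measurable_EFinP; apply: measurable_funX; exact: measurable_conv.
- by apply: measurable_funeM.
- move=> x _; rewrite patchE mem_setE in_itv/=; case: ifP => [/andP[x0 xt]|_]; last first.
    by rewrite mule_ge0// ?mule_ge0// lee_fin// divr_ge0// ltW.
  rewrite abel1E subr_gt0 xt mul1e.
  apply: (le_trans (conv_abel_sqr b x W b0 mW W0)).
  apply: lee_wpmul2r => //; rewrite lee_fin ler_pM2r ?invr_gt0//.
  by apply: abel_ndecr; lra.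
Qed.

(** The weight [(t - r)^b] is at most [T^b] far from [t], and at most [d^b] for
[r >= t - d]; the second factor can be made small. *)
Lemma energy_split (b t d T : R) (W : R -> R) : 0 < b -> 0 <= d -> t <= T ->
  measurable_fun setT W ->
  (forall r, r <= 0 -> W r = 0) -> (\int[mu]_r (W r ^+ 2)%:E < +oo)%E ->
  (\int[mu]_r (abel (b + 1) (t - r) / b * W r ^+ 2)%:E <=
   (abel (b + 1) T / b * energy W (t - d) + abel (b + 1) d / b * energy W t)%:E)%E.
Proof.
move=> b0 d0 tT mW W0 Wfin.
have mW2 : measurable_fun setT (fun r : R => W r ^+ 2) by exact: measurable_funX.
have mE s : measurable_fun setT (fun r : R => (abel 1 (s - r) * W r ^+ 2)%:E).
  by apply/measurable_EFinP; apply: measurable_funM => //; exact: measurable_abel_subl.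
have E0 s r : (0 <= (abel 1 (s - r) * W r ^+ 2)%:E)%E by rewrite lee_fin mulr_ge0 ?abel_ge0 ?sqr_ge0.
have EE s : (energy W s)%:E = (\int[mu]_r (abel 1 (s - r) * W r ^+ 2)%:E)%E.
  rewrite fineK// ge0_fin_numE ?integral_ge0//.
  apply: le_lt_trans Wfin; apply: ge0_le_integral => //.
  - exact: mE.
  - by apply/measurable_EFinP.
  - by move=> r _; rewrite lee_fin abel1E; case: (_ < _); rewrite ?mul1r// mul0r sqr_ge0.
have P0 x : 0 <= abel (b + 1) x / b by rewrite divr_ge0 ?abel_ge0 ?ltW.
have key r : abel (b + 1) (t - r) / b * W r ^+ 2 <=
    abel (b + 1) T / b * (abel 1 (t - d - r) * W r ^+ 2) +
    abel (b + 1) d / b * (abel 1 (t - r) * W r ^+ 2).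
  rewrite !(mulrA _ _ (_ ^+ 2)) -mulrDl.
  have [r0|r0] := leP r 0; first by rewrite W0// expr0n /= !mulr0.
  apply: ler_wpM2r; first exact: sqr_ge0.
  rewrite !abel1E !subr_gt0.
  have [rt|rt] := ltP r t; last first.
    rewrite (@abel_le0E _ (b + 1) (t - r)); last by lra.
    by rewrite mul0r addr_ge0// mulr_ge0.
  have [rd|rd] := ltP r (t - d).
    rewrite !mulr1; apply: ler_wpDr => //; rewrite ler_pM2r ?invr_gt0//.
    by apply: abel_ndecr; lra.
  rewrite mulr0 add0r mulr1 ler_pM2r ?invr_gt0//.
  by apply: abel_ndecr; lra.
move: (abel (b + 1) T / b) (abel (b + 1) d / b) (P0 T) (P0 d) key => pT pd PT0 Pd0 key.
rewrite [leRHS](_ : _ = pT%:E * \int[mu]_r (abel 1 (t - d - r) * W r ^+ 2)%:E +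
  pd%:E * \int[mu]_r (abel 1 (t - r) * W r ^+ 2)%:E)%E; last by rewrite -(EE (t - d)) -(EE t).
rewrite -!ge0_integralZl//; try exact: mE.
have mZ (k : R) s : measurable_fun setT (fun r : R => k%:E * (abel 1 (s - r) * W r ^+ 2)%:E)%E.
  by apply: measurable_funeM.
have Z0 x s r : 0 <= x -> (0 <= x%:E * (abel 1 (s - r) * W r ^+ 2)%:E)%E.
  by move=> x0; rewrite mule_ge0// lee_fin.
rewrite -ge0_integralD//; try exact: mZ; try (by move=> x _; exact: Z0).
apply: ge0_le_integral => //.
- by move=> r _; rewrite lee_fin mulr_ge0 ?sqr_ge0.
- apply/measurable_EFinP; apply: measurable_funM => //; apply: measurable_funM => //.
  exact: measurable_abel_subl.
- by apply: emeasurable_funD; exact: mZ.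
- by move=> r _; rewrite -!EFinM -EFinD lee_fin.
Qed.

(** Each step of length [d] multiplies the constant by [D] and adds [2], so a finite
horizon is reached with a constant independent of [phi] and [eps]. *)
Lemma delay_gronwall (D d : R) (n : nat) : 0 <= D -> 0 < d ->
  exists2 C : R, 0 < C & forall (phi : R -> R) (eps t : R), 0 <= eps ->
    (forall s, s <= 0 -> phi s <= 0) ->
    (forall s, 0 < s <= t -> phi s <= 2 * eps + D * phi (s - d)) ->
    forall s, s <= t -> s <= n%:R * d -> phi s <= C * eps.
Proof.
move=> D0 d0; elim: n => [|n [C C0 IH]].
  exists 1 => // phi eps t e0 p0 _ s _; rewrite mul0r mul1r => s0.
  by apply: le_trans (p0 _ s0) e0.
exists (2 + D * C); first by rewrite ltr_wpDr// mulr_ge0// ltW.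
move=> phi eps t e0 p0 ph s st sn.
have [s0|s0] := leP s 0.
  by apply: le_trans (p0 _ s0) _; rewrite mulr_ge0// addr_ge0// mulr_ge0// ltW.
apply: (le_trans (ph _ _)); first by rewrite s0.
rewrite [leRHS]mulrDl lerD2l -mulrA ler_wpM2l//.
apply: (IH phi eps t) => //; first by lra.
by move: sn; rewrite -natr1 mulrDl mul1r; lra.
Qed.

End estimates.
(** * The Riemann-Liouville derivative *)

Section fractional.
Context {R : realType}.
Notation mu := (@lebesgue_measure R).
Implicit Types (t s T : R) (y w : R -> R).

Lemma Gamma_gt0 (x : R) : 0 < x <= 1 -> 0 < Gamma x.
Proof.
move=> /andP[x0 x1].
pose f s := s `^ (x - 1) * expR (- s) : R.
have f0 s : 0 <= f s by rewrite mulr_ge0 ?powR_ge0 ?expR_ge0.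
have mf : measurable_fun setT (fun s => (f s)%:E).
  apply/measurable_EFinP; apply: measurable_funM; first exact: measurable_powR.
  by apply: (measurableT_comp (f := expR)) => //; exact: measurable_expR.
have m2 : measurable_fun setT (fun s : R => (abel x s * abel 1 (1 - s))%:E).
  apply/measurable_EFinP; apply: measurable_funM; first exact: measurable_abel.
  exact: measurable_abel_subl.
have me : measurable_fun setT (fun s : R => (exponential_pdf 1 s)%:E).
  by apply/measurable_EFinP; exact: measurable_exponential_pdf.
have e0 s : 0 <= exponential_pdf 1 s :> R by exact: exponential_pdf_ge0.
have fin : (\int[mu]_(s in `]0%R, +oo[) (f s)%:E < +oo)%E.
  apply: (@le_lt_trans _ _ (\int[mu]_s ((abel x s * abel 1 (1 - s))%:E + (exponential_pdf 1 s)%:E))%E).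
    rewrite integral_mkcond; apply: ge0_le_integral => //.
    - by move=> s _; rewrite patchE; case: ifP => // _; rewrite lee_fin.
    - by apply/(measurable_restrictT _ _).1 => //; apply: measurable_funTS.
    - by apply: emeasurable_funD.
    - move=> s _; rewrite patchE mem_setE in_itv/= andbT; case: ifP => s0; last first.
        by rewrite -EFinD lee_fin addr_ge0// mulr_ge0 ?abel_ge0.
      rewrite -EFinD lee_fin exponential_pdfE ?(ltW s0)// mul1r mulN1r abel1E subr_gt0 /f.
      have [s1|s1] := ltP s 1.
        rewrite mulr1 abel_gt0E//; apply: ler_wpDr; first exact: expR_ge0.
        by rewrite ler_piMr ?powR_ge0// expR_le1 oppr_le0 (ltW s0).
      rewrite mulr0 add0r ler_piMl ?expR_ge0//.
      by rewrite -[leRHS](powRr0 s); apply: ler_powR => //; lra.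
  rewrite ge0_integralD//=; last 2 first.
  - by move=> s _; rewrite lee_fin mulr_ge0 ?abel_ge0.
  - by move=> s _; rewrite lee_fin.
  rewrite integral_exponential_pdf//.
  have -> : (\int[mu]_s (abel x s * abel 1 (1 - s))%:E = (abel (x + 1) 1 / x)%:E)%E.
    have <- := @kconv_abel1l R x 1 x0; apply: eq_integral => s _; by rewrite mulrC.
  by rewrite -EFinD ltry.
apply: (@lt_le_trans _ _ (expR (- 1))); first exact: expR_gt0.
rewrite -lee_fin /Gamma /Rintegral fineK; last first.
  rewrite ge0_fin_numE//; apply: integral_ge0 => s _; rewrite lee_fin; exact: (f0 s).
have -> : ((expR (-1))%:E = \int[mu]_(s in `]0%R, 1%R[) (expR (-1))%:E)%E.
  by rewrite integral_cst//= lebesgue_measure_itv/= lte_fin ltr01 oppr0 adde0 mule1.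
rewrite [leLHS]integral_mkcond [leRHS]integral_mkcond; apply: ge0_le_integral => //.
- by move=> s _; rewrite patchE; case: ifP => // _; rewrite lee_fin expR_ge0.
- by apply/(measurable_restrictT _ _).1.
- by apply/(measurable_restrictT _ _).1 => //; apply: measurable_funTS.
- move=> s _; rewrite !patchE !mem_setE !in_itv/= andbT.
  have [s0|//] := ltP 0 s; case: ltP => //= s1; last by rewrite lee_fin; exact: (f0 s).
  rewrite lee_fin -[leLHS]mul1r; apply: ler_pM => //.
    by rewrite -(abel_gt0E x _ s0) abel_ge1// s0 ltW.
  by rewrite ler_expR lerN2 ltW.
Qed.

Lemma L2norm_sqr t w : (L2norm t w ^+ 2 = \int[mu]_x (((w \_ `]0, t[) x) ^+ 2)%:E)%E.
Proof. exact: Lnorm2_sqr. Qed.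

Lemma L2P t w : L2 t w -> measurable_fun setT (w \_ `]0, t[) /\
  (\int[mu]_x (((w \_ `]0, t[) x) ^+ 2)%:E < +oo)%E.
Proof.
rewrite /L2 /= inE => /andP[]; rewrite inE/= => mw; rewrite inE/= /finite_norm => fw.
split => //; rewrite -L2norm_sqr expe2 lte_mul_pinfty//; first exact: Lnorm_ge0.
by rewrite ge0_fin_numE//; exact: Lnorm_ge0.
Qed.

Lemma restrict_le0 t w s : s <= 0 -> (w \_ `]0, t[) s = 0.
Proof. by move=> s0; rewrite patchE mem_setE in_itv/= ltNge s0. Qed.

Lemma L2_integrable t w : L2 t w -> mu.-integrable setT (EFin \o (w \_ `]0, t[)).
Proof.
move=> /L2P[mw fw].
have i1 : mu.-integrable setT (EFin \o (\1_`]0, t[ : R -> R)) by exact: integrable_indic_itv.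
have i2 : mu.-integrable setT (fun x => (((w \_ `]0, t[) x) ^+ 2)%:E).
  apply/integrableP; split; first by apply/measurable_EFinP; exact: measurable_funX.
  by under eq_integral do rewrite gee0_abs ?lee_fin ?sqr_ge0//.
apply: (le_integrable _ _ _ (integrableD measurableT i1 i2)) => //.
  exact/measurable_EFinP.
move=> x _; rewrite /= lee_fin indicE patchE; case: ifP => xt /=.
- by rewrite ler_norml ger0_norm; nra.
- by rewrite normr0.
Qed.

Lemma L2_integrable_itv t w : L2 t w -> mu.-integrable `]0, t[ (EFin \o w).
Proof.
move=> /L2_integrable; rewrite (_ : _ \o _ = (EFin \o w) \_ `]0, t[).
  by move/(integrable_mkcond _ _).2; apply.
by apply/funext => x; rewrite /= !patchE; case: ifP.
Qed.

Lemma conv_abel1 (F : R -> R) b : measurable_fun setT F -> (forall s, s <= 0 -> F s = 0) ->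
  conv (abel 1) F b = \int[mu]_(x in `]0, b]) F x.
Proof.
move=> mF F0; rewrite /conv /Rintegral -integral_itv_bndo_bndc; last first.
  by apply/measurable_EFinP; exact: measurable_funTS.
congr fine; rewrite [RHS]integral_mkcond; apply: eq_integral => s _.
rewrite patchE mem_setE in_itv/= abel1E subr_gt0.
have [s0|s0] /= := ltP 0 s; last by rewrite F0// mulr0.
by case: (ltP s b) => _; rewrite ?mul1r ?mul0r.
Qed.

Lemma conv_le0 (a : R) (F : R -> R) s : (forall s, s <= 0 -> F s = 0) -> s <= 0 ->
  conv (abel a) F s = 0.
Proof.
move=> F0 s0; rewrite /conv (@eq_Rintegral _ _ _ _ _ (fun=> 0)); first by rewrite Rintegral_cst// mul0r.
move=> r _; have [r0|r0] := leP r 0; first by rewrite F0// mulr0.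
by rewrite abel_le0E ?mul0r//; lra.
Qed.

Lemma integrable_kernel (k F : R -> R) b : measurable_fun setT k -> (forall x, 0 <= k x) ->
  {homo k : x z / x <= z} -> (forall s, s <= 0 -> F s = 0) ->
  mu.-integrable setT (EFin \o F) -> mu.-integrable setT (fun s => (k (b - s) * F s)%:E).
Proof.
move=> mk k0 kh F0 iF.
have mF : measurable_fun setT F by apply/measurable_EFinP; exact: measurable_int iF.
apply: (le_integrable _ _ _ (integrableZl measurableT (k b) iF)) => //.
  by apply/measurable_EFinP; apply: measurable_funM => //; exact: measurable_subl.
move=> s _ /=; rewrite lee_fin !normrM !(ger0_norm (k0 _)).
have [s0|s0] := leP s 0; first by rewrite F0// normr0 !mulr0.
by apply: ler_wpM2r => //; apply: kh; lra.
Qed.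

(** Tonelli's theorem for the absolute values: their convolution with [abel b] has a
finite integral up to [t]. *)
Lemma integrable_conv (b t : R) (W : R -> R) : 0 < b ->
  mu.-integrable setT (EFin \o W) -> (forall s, s <= 0 -> W s = 0) ->
  mu.-integrable `]0, t[ (EFin \o (conv (abel b) W)).
Proof.
move=> b0 iW W0.
have mW : measurable_fun setT W by apply/measurable_EFinP; exact: measurable_int iW.
have mk (a : R) : measurable_fun setT (abel a) := measurable_abel a.
have k0 (a x : R) : 0 <= abel a x := abel_ge0 a x.
have mN : measurable_fun setT (fun x => `|W x|) by exact: measurableT_comp.
have T := @kconv_tonelli _ (abel 1) (abel b) (fun x => `|W x|) (fun x => abel (b + 1) x / b) t
  (mk 1) (mk b) mN (k0 1) (k0 b) (fun z => normr_ge0 _) (fun z => kconv_abel1l b z b0).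
have iN : mu.-integrable setT (fun s => (abel (b + 1) (t - s) / b * `|W s|)%:E).
  apply: (@integrable_kernel (fun x => abel (b + 1) x / b) (fun s => `|W s|)).
  - by apply: measurable_funM.
  - by move=> x; exact: divr_ge0 (k0 _ _) (ltW b0).
  - by move=> x z xz; rewrite ler_pM2r ?invr_gt0//; apply: abel_ndecr => //; lra.
  - by move=> s s0; rewrite W0// normr0.
  - exact: integrable_norm iW.
apply/integrableP; split.
  by apply/measurable_EFinP; apply: measurable_funTS; exact: measurable_conv.
have I0 x : (0 <= \int[mu]_s (abel b (x - s) * `|W s|)%:E)%E.
  by apply: integral_ge0 => r _; rewrite lee_fin mulr_ge0.
have mI : measurable_fun setT (fun x : R => \int[mu]_s (abel b (x - s) * `|W s|)%:E)%E.
  apply: (measurable_fubini (fun p : R * R => (abel b (p.1 - p.2) * `|W p.2|)%:E)).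
  apply/measurable_EFinP.
  exact: (@measurable_convand R (abel b) (fun r => `|W r|)).
apply: (@le_lt_trans _ _ (\int[mu]_x ((abel 1 (t - x))%:E * \int[mu]_s (abel b (x - s) * `|W s|)%:E))%E).
  rewrite [leLHS]integral_mkcond; apply: ge0_le_integral => //.
  - by move=> x _; rewrite patchE; case: ifP.
  - apply/(measurable_restrictT _ _).1 => //; apply: measurable_funTS.
    apply: measurableT_comp => //; apply/measurable_EFinP; exact: measurable_conv.
  - apply: emeasurable_funM => //; apply/measurable_EFinP; exact: measurable_abel_subl.
  - move=> x _; rewrite patchE mem_setE in_itv/=; case: ifP => [/andP[x0 xt]|_]; last first.
      by rewrite mule_ge0// lee_fin.
    rewrite abel1E subr_gt0 xt mul1e /=.
    have -> : (\int[mu]_s (abel b (x - s) * `|W s|)%:E = \int[mu]_s `|(abel b (x - s) * W s)%:E|)%E.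
      by apply: eq_integral => r _; rewrite /= normrM ger0_norm.
    have mx : measurable_fun setT (fun s : R => (abel b (x - s) * W s)%:E).
      by apply/measurable_EFinP; apply: measurable_funM => //; exact: measurable_abel_subl.
    have [fin|] := ltP (\int[mu]_s `|(abel b (x - s) * W s)%:E|)%E +oo%E; last first.
      by rewrite leye_eq => /eqP ->; rewrite leey.
    have ik : mu.-integrable setT (fun s => (abel b (x - s) * W s)%:E) by apply/integrableP.
    have N := le_normr_Rintegral measurableT ik.
    rewrite -(@fineK _ (\int[mu]_s `|_|)%E) ?lee_fin//.
    by rewrite ge0_fin_numE// integral_ge0.
rewrite T; have /integrableP[_] := iN; apply: le_lt_trans.
rewrite le_eqVlt; apply/orP; left; apply/eqP; apply: eq_integral => s _.
by rewrite gee0_abs// lee_fin mulr_ge0// (divr_ge0 (k0 _ _) (ltW b0)).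
Qed.

Lemma RLint_conv (beta T : R) y x : 0 < x < T ->
  RLint beta y x = (Gamma (1 - beta))^-1 * conv (abel (1 - beta)) (y \_ `]0, T[) x.
Proof.
move=> /andP[x0 xT]; rewrite /RLint /conv; congr (_ * _).
rewrite Rintegral_mkcond; apply: eq_Rintegral => s _.
rewrite !patchE !mem_setE !in_itv/=.
have [s0|s0] /= := ltP 0 s; last by rewrite mulr0.
have [sx|sx] := ltP s x.
  rewrite (lt_trans sx xT) abel_gt0E ?subr_gt0//; congr (_ `^ _ * _); ring.
by rewrite abel_le0E ?mul0r//; lra.
Qed.

Lemma RL_primitive (beta T t b : R) y w : 0 < beta -> beta < 1 / 2 -> t <= T ->
  L2 T y -> L2 t w -> dist_represents t (RLderiv T beta y) w -> 0 < b < t ->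
  conv (abel (1 - beta)) (y \_ `]0, T[) b = Gamma (1 - beta) * \int[mu]_(x in `]0, b]) w x.
Proof.
move=> be0 be1 tT Ly Lw rep /andP[b0 bt].
have G0 : 0 < Gamma (1 - beta) by apply: Gamma_gt0; lra.
have [mY fY] := L2P T y Ly.
have a1 : 1 / 2 < 1 - beta by lra.
have a2 : 1 - beta <= 1 by lra.
have Y0 := restrict_le0 T y.
pose u x := (Gamma (1 - beta))^-1 * conv (abel (1 - beta)) (y \_ `]0, T[) x.
have cu : continuous u.
  by move=> x; apply: cvgMr; exact: (conv_abel_continuous _ _ a1 a2 mY Y0 fY).
have rep' : dist_represents t (dist_deriv T u) w.
  move=> phi tphi; rewrite -(rep phi tphi) /RLderiv /dist_deriv; apply: congr1.
  apply: eq_Rintegral => x; rewrite inE/= in_itv/= => xT.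
  by rewrite (@RLint_conv beta T).
have := weak_deriv_primitive T t b u w tT b0 bt cu (L2_integrable_itv t w Lw) rep'.
rewrite /u [in X in _ - X]conv_le0// mulr0 subr0 => <-.
by rewrite mulVKf// gt_eqF.
Qed.

(** Abel's inversion. The primitives of [B * y] and of the convolution on the right
coincide: both are the convolution of [abel beta] with the function of
[RL_primitive], because [abel beta] convolved with [abel (1 - beta)] is [B] times
the Heaviside function. *)
Lemma RL_inversion (beta T t : R) y w : 0 < beta -> beta < 1 / 2 -> t <= T ->
  L2 T y -> L2 t w -> dist_represents t (RLderiv T beta y) w ->
  {ae mu, forall x, x \in `]0, t[ ->
    beta_int beta (1 - beta) * y x =
    conv (abel beta) (fun s => Gamma (1 - beta) * (w \_ `]0, t[) s) x}.
Proof.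
move=> be0 be1 tT Ly Lw rep.
have [mY fY] := L2P T y Ly; have [mw fw] := L2P t w Lw.
have Y0 := restrict_le0 T y.
set Y := (y \_ `]0, T[) in mY fY Y0.
set G := Gamma (1 - beta); set B := beta_int beta (1 - beta).
pose W s := G * (w \_ `]0, t[) s.
have W0 s : s <= 0 -> W s = 0 by move=> s0; rewrite /W restrict_le0// mulr0.
have iW : mu.-integrable setT (EFin \o W).
  have := integrableZl measurableT G (L2_integrable t w Lw).
  by apply: eq_integrable.
have iY : mu.-integrable setT (EFin \o Y) := L2_integrable T y Ly.
have mW : measurable_fun setT W by apply/measurable_EFinP; exact: measurable_int iW.
have prim s : s < t -> conv (abel (1 - beta)) Y s = conv (abel 1) W s.
  move=> st; have [s0|s0] := leP s 0; first by rewrite !conv_le0.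
  rewrite conv_abel1// (RL_primitive beta T t s y w)//; last by rewrite s0.
  rewrite -/G -RintegralZl//; last first.
    apply: integrableS (L2_integrable_itv t w Lw) => //.
    by move=> x /=; rewrite !in_itv/=; lra.
  apply: eq_Rintegral => x; rewrite inE/= in_itv/= => xs.
  by rewrite /W patchE mem_setE in_itv/= ifT//; lra.
have mk (a : R) : measurable_fun setT (abel a) := measurable_abel a.
have k0 (a x : R) : 0 <= abel a x := abel_ge0 a x.
have hm a : 1 <= a -> {homo abel a : x z / x <= z} by move=> a1 x z; exact: abel_ndecr.
have key b : b < t -> B * conv (abel 1) Y b = conv (abel 1) (conv (abel beta) W) b.
  move=> bt.
  have b01 : 0 < beta <= 1 by lra.
  have a01 : 0 < 1 - beta <= 1 by lra.
  have B0 : 0 <= B by have [_] := beta_int_spec _ _ b01 a01; rewrite -/B; lra.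
  have sumE : beta + (1 - beta) = 1 by ring.
  have mh : {homo (fun x => abel (beta + 1) x / beta) : x z / x <= z}.
    by move=> x z xz; rewrite ler_pM2r ?invr_gt0//; apply: hm => //; lra.
  have im : mu.-integrable setT (fun s => (abel (beta + 1) (b - s) / beta * W s)%:E).
    apply: (@integrable_kernel (fun x => abel (beta + 1) x / beta)) => //.
    - exact: measurable_funM.
    - by move=> x; exact: divr_ge0 (k0 _ _) (ltW be0).
  rewrite (@conv_conv _ (abel 1) (abel beta) W (fun x => abel (beta + 1) x / beta))//; last first.
    by move=> z; exact: kconv_abel1l.
  rewrite -(@conv_conv _ (abel beta) (abel 1) W (fun x => abel (beta + 1) x / beta))//; last first.
    by move=> z; exact: kconv_abel1r.
  transitivity (conv (abel beta) (conv (abel (1 - beta)) Y) b); last first.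
    apply: eq_Rintegral => s _; have [sb|sb] := ltP s b; first by rewrite prim//; lra.
    by rewrite abel_le0E ?mul0r//; lra.
  rewrite (@conv_conv _ (abel beta) (abel (1 - beta)) Y (fun x => B * abel 1 x))//.
  - rewrite /conv -RintegralZl//; last by apply: integrable_kernel => //; exact: hm.
    by apply: eq_Rintegral => s _; rewrite mulrA.
  - by move=> z; rewrite kconv_abel// sumE.
  - apply: (@integrable_kernel (fun x => B * abel 1 x)) => //.
    + exact: measurable_funM.
    + by move=> x; rewrite mulr_ge0.
    + by move=> x z xz; apply: ler_wpM2l => //; exact: hm.
have iB : mu.-integrable `]0, t[ (EFin \o (fun x => B * Y x)).
  have h : mu.-integrable setT (EFin \o (fun x => B * Y x)).
    by have := integrableZl measurableT B iY; apply: eq_integrable.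
  exact: integrableS h.
have iC := integrable_conv beta t W be0 iW W0.
have := @zero_primitive_ae _ (fun x => B * Y x - conv (abel beta) W x) t _ _.
have iBC : mu.-integrable `]0, t[ (EFin \o (fun x => B * Y x - conv (abel beta) W x)).
  exact: (integrableB _ iB iC).
move=> /(_ iBC) ae0.
have {ae0} : {ae mu, forall x, x \in `]0, t[ -> B * Y x - conv (abel beta) W x = 0}.
  apply: ae0 => b /andP[b0 bt].
  have sub : `]0, b] `<=` `]0, t[ by move=> x /=; rewrite !in_itv/=; lra.
  rewrite RintegralB//; last 2 first.
  - exact: integrableS iB.
  - exact: integrableS iC.
  rewrite RintegralZl//; last by apply: integrableS iY.
  rewrite -!conv_abel1//.
  - by rewrite key// subrr.
  - exact: measurable_conv.
  - by move=> s s0; exact: conv_le0.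
apply: filterS; first exact: (ae_filter_ringOfSetsType mu).
move=> x H xt; have := H xt; rewrite /Y patchE mem_setE ifT; last first.
  by move: xt; rewrite !in_itv/=; lra.
by move=> /eqP; rewrite subr_eq0 => /eqP.
Qed.

Lemma test_fun_out t (phi : R -> R) x : test_fun t phi -> x \notin `]0, t[ -> phi x = 0.
Proof.
move=> [_ _ sub] xt; apply/eqP; apply: contraNT xt => px.
by have := sub x (@subset_closure _ [set x | phi x != 0] x px).
Qed.

Lemma test_funS s t (phi : R -> R) : s <= t -> test_fun s phi -> test_fun t phi.
Proof.
move=> st [sm cp sub]; split => //; apply: (subset_trans sub) => x /=.
by rewrite !in_itv/=; lra.
Qed.

Lemma dist_represents_le s t F w : s <= t -> dist_represents t F w -> dist_represents s F w.
Proof.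
move=> st rep phi tphi; rewrite (rep phi (test_funS s t phi st tphi)).
rewrite Rintegral_mkcond [RHS]Rintegral_mkcond; apply: eq_Rintegral => x _.
rewrite !patchE !mem_setE; case: (boolP (x \in `]0, s[)) => xs.
  by rewrite ifT//; move: xs; rewrite !in_itv/=; lra.
by rewrite (test_fun_out s phi x tphi xs) mulr0; case: ifP.
Qed.

(** Truncating earlier amounts to multiplying by a translated Heaviside function,
which identifies norms on [(0, s)] with values of [energy]. *)
Lemma restrict_abel1 s t w : s <= t ->
  w \_ `]0, s[ = (fun x => abel 1 (s - x) * (w \_ `]0, t[) x).
Proof.
move=> st; apply/funext => x; rewrite !patchE !mem_setE !in_itv/= abel1E subr_gt0.
have [x0|x0] /= := ltP 0 x; last by rewrite mulr0.
by have [xs|xs] := ltP x s; rewrite ?mul0r// mul1r ifT//; lra.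
Qed.

Lemma L2S s t w : s <= t -> L2 t w -> L2 s w.
Proof.
move=> st Lw; have [mw fw] := L2P t w Lw.
have mws : measurable_fun setT (w \_ `]0, s[).
  by rewrite (restrict_abel1 s t w st); apply: measurable_funM => //; exact: measurable_abel_subl.
rewrite /L2 /= inE; apply/andP; split; rewrite inE//= /finite_norm.
apply: sqr_lty; rewrite Lnorm2_sqr; apply: le_lt_trans fw; apply: ge0_le_integral => //.
- by move=> x _; rewrite lee_fin sqr_ge0.
- by apply/measurable_EFinP; exact: measurable_funX.
- by apply/measurable_EFinP; exact: measurable_funX.
- move=> x _; rewrite lee_fin (restrict_abel1 s t w st) abel1E.
  by case: (_ < _); rewrite ?mul1r// mul0r expr0n /= sqr_ge0.
Qed.

Lemma L2norm_energy s t w : s <= t -> L2 t w ->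
  (L2norm s w ^+ 2 = (energy (w \_ `]0, t[) s)%:E)%E.
Proof.
move=> st Lw; have [mw fw] := L2P s w (L2S s t w st Lw).
rewrite L2norm_sqr /energy.
have -> : (\int[mu]_r (abel 1 (s - r) * (w \_ `]0, t[) r ^+ 2)%:E =
           \int[mu]_x (((w \_ `]0, s[) x) ^+ 2)%:E)%E.
  apply: eq_integral => x _; rewrite (restrict_abel1 s t w st) abel1E exprMn.
  by case: (_ < _); rewrite ?expr1n ?expr0n.
by rewrite fineK// ge0_fin_numE// integral_ge0// => x _; rewrite lee_fin sqr_ge0.
Qed.

(** Two representatives have the same primitives by [RL_primitive], hence agree almost
everywhere: the infimum in the definition of the norm is over a single class. *)
Lemma dist_L2norm_eq (beta T t : R) y w : 0 < beta -> beta < 1 / 2 -> t <= T ->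
  L2 T y -> L2 t w -> dist_represents t (RLderiv T beta y) w ->
  dist_L2norm t (RLderiv T beta y) = L2norm t w.
Proof.
move=> be0 be1 tT Ly Lw rep; apply/eqP; rewrite eq_le; apply/andP; split.
  by apply: ereal_inf_lbound; exists w.
apply: le_ereal_inf_tmp => _ [w' [Lw' rep'] <-].
have G0 : 0 < Gamma (1 - beta) by apply: Gamma_gt0; lra.
have iw := L2_integrable_itv t w Lw; have iw' := L2_integrable_itv t w' Lw'.
have iB : mu.-integrable `]0, t[ (EFin \o (fun x => w x - w' x)).
  exact: (integrableB _ iw iw').
have ae0 : {ae mu, forall x, x \in `]0, t[ -> w x - w' x = 0}.
  apply: zero_primitive_ae => // b bt; have /andP[b0 bt'] := bt.
  have sub : `]0, b] `<=` `]0, t[ by move=> x /=; rewrite !in_itv/=; lra.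
  rewrite RintegralB//; [|exact: integrableS iw|exact: integrableS iw'].
  have E := RL_primitive beta T t b y w be0 be1 tT Ly Lw rep bt.
  have E' := RL_primitive beta T t b y w' be0 be1 tT Ly Lw' rep' bt.
  have := etrans (esym E) E'; move/(mulfI (lt0r_neq0 G0)) => ->.
  by rewrite subrr.
rewrite -lee_sqr ?Lnorm_ge0// !L2norm_sqr le_eqVlt; apply/orP; left; apply/eqP.
have [mw _] := L2P t w Lw; have [mw' _] := L2P t w' Lw'.
apply: ae_eq_integral => //.
- by apply/measurable_EFinP; exact: measurable_funX.
- by apply/measurable_EFinP; exact: measurable_funX.
move: ae0; apply: filterS; first exact: (ae_filter_ringOfSetsType mu).
move=> x H _; rewrite !patchE mem_setE; case: ifP => // xt.
by move/eqP: (H xt); rewrite subr_eq0 => /eqP ->.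
Qed.

Lemma energy_le0 W s : (forall r, r <= 0 -> W r = 0) -> s <= 0 -> energy W s = 0.
Proof.
move=> W0 s0; rewrite /energy integral0_eq// => r _.
have [r0|r0] := leP r 0; first by rewrite W0// expr0n mulr0.
by rewrite abel_le0E ?mul0r//; lra.
Qed.

Lemma energyZ (k : R) (W : R -> R) s : measurable_fun setT W -> (\int[mu]_x (W x ^+ 2)%:E < +oo)%E ->
  energy (fun x => k * W x) s = k ^+ 2 * energy W s.
Proof.
move=> mW fW; rewrite /energy.
have m1 : measurable_fun setT (fun r : R => (abel 1 (s - r) * W r ^+ 2)%:E).
  apply/measurable_EFinP; apply: measurable_funM; first exact: measurable_abel_subl.
  exact: measurable_funX.
have E0 r : (0 <= (abel 1 (s - r) * W r ^+ 2)%:E)%E by rewrite lee_fin mulr_ge0 ?abel_ge0 ?sqr_ge0.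
transitivity (fine ((k ^+ 2)%:E * \int[mu]_r (abel 1 (s - r) * W r ^+ 2)%:E)%E).
  congr fine; rewrite -ge0_integralZl//; last by rewrite lee_fin sqr_ge0.
  by apply: eq_integral => r _; rewrite -EFinM; congr EFin; rewrite exprMn; ring.
rewrite fineM// ge0_fin_numE ?integral_ge0//.
apply: le_lt_trans fW; apply: ge0_le_integral => //.
- by apply/measurable_EFinP; exact: measurable_funX.
- by move=> r _; rewrite lee_fin abel1E; case: (_ < _); rewrite ?mul1r// mul0r sqr_ge0.
Qed.

(** The delayed estimate of [y] by its fractional derivative: [RL_inversion] followed
by [integral_conv_sqr] and [energy_split]. *)
Lemma L2norm_le_energy (beta T t s d : R) y w : 0 < beta -> beta < 1 / 2 -> t <= T ->
  L2 T y -> L2 t w -> dist_represents t (RLderiv T beta y) w -> s <= t -> 0 <= d ->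
  (L2norm s y ^+ 2 <= ((beta_int beta (1 - beta)) ^- 2 * (abel (beta + 1) T / beta) *
     (abel (beta + 1) T / beta *
        energy (fun x => Gamma (1 - beta) * (w \_ (`]0, t[)) x) (s - d) +
      abel (beta + 1) d / beta *
        energy (fun x => Gamma (1 - beta) * (w \_ (`]0, t[)) x) s))%:E)%E.
Proof.
move=> be0 be1 tT Ly Lw rep st d0.
pose W x := Gamma (1 - beta) * (w \_ (`]0, t[)) x; pose c x := abel (beta + 1) x / beta.
rewrite -/W -/(c T) -/(c d).
have [mw fw] := L2P t w Lw.
have mW : measurable_fun setT W by exact: measurable_funM.
have W0 r : r <= 0 -> W r = 0 by move=> r0; rewrite /W restrict_le0// mulr0.
set B := beta_int beta (1 - beta).
have B0 : 0 < B.
  have b01 : 0 < beta <= 1 by lra.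
  have a01 : 0 < 1 - beta <= 1 by lra.
  by have [_] := beta_int_spec _ _ b01 a01; rewrite -/B; lra.
have sT : s <= T by lra.
have [mYs _] := L2P s y (L2S s T y sT Ly).
have fW : (\int[mu]_x (W x ^+ 2)%:E < +oo)%E.
  rewrite /W; under eq_integral do rewrite exprMn EFinM.
  rewrite ge0_integralZl//.
  - by apply: lte_mul_pinfty => //; rewrite lee_fin sqr_ge0.
  - by apply/measurable_EFinP; exact: measurable_funX.
  - by move=> x _; rewrite lee_fin sqr_ge0.
  - by rewrite lee_fin sqr_ge0.
have cT0 : 0 <= c T by exact: divr_ge0 (abel_ge0 _ _) (ltW be0).
have inv := RL_inversion beta T t y w be0 be1 tT Ly Lw rep.
rewrite L2norm_sqr.
have -> : (\int[mu]_x (((y \_ `]0, s[) x) ^+ 2)%:E =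
           \int[mu]_(x in `]0%R, s[) ((B ^- 2)%:E * (conv (abel beta) W x ^+ 2)%:E))%E.
  rewrite [RHS]integral_mkcond; apply: ae_eq_integral => //.
  - by apply/measurable_EFinP; exact: measurable_funX.
  - apply/(measurable_restrictT _ _).1 => //; apply: measurable_funTS.
    apply: measurable_funeM; apply/measurable_EFinP; apply: measurable_funX.
    exact: (measurable_conv (abel beta) W (measurable_abel beta) mW).
  move: inv; apply: filterS; first exact: (ae_filter_ringOfSetsType mu).
  move=> x H _; rewrite !patchE !mem_setE; case: ifP => xs; last by rewrite expr0n.
  rewrite -H; last by move: xs; rewrite !in_itv/=; lra.
  by rewrite -EFinM exprMn -/B mulrA mulVf ?mul1r// expf_neq0// gt_eqF.
rewrite ge0_integralZl//; last 3 first.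
- apply/measurable_EFinP; apply: measurable_funTS; apply: measurable_funX.
  exact: (measurable_conv (abel beta) W (measurable_abel beta) mW).
- by move=> x _; rewrite lee_fin sqr_ge0.
- by rewrite lee_fin invr_ge0 sqr_ge0.
rewrite -mulrA [leRHS]EFinM; apply: lee_wpmul2l; first by rewrite lee_fin invr_ge0 sqr_ge0.
apply: (le_trans (integral_conv_sqr beta s T W be0 sT mW W0)).
rewrite [leRHS]EFinM; apply: lee_wpmul2l => //.
exact: (energy_split beta s d T W be0 d0 sT mW W0 fW).
Qed.

End fractional.

Theorem lemma3p5 (R : realType) (beta A T : R)
    (hbeta0 : 0 < beta) (hbeta1 : beta < 1 / 2) (hA : 0 < A) (hT : 0 < T) :
  exists2 C : R, 0 < C &
    forall (eps : R) (y : R -> R), 0 < eps -> Hbeta_0 beta T y ->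
      (forall t : R, 0 < t < T ->
         (dist_L2norm t (RLderiv T beta y) ^+ 2
            <= eps%:E + A%:E * L2norm t y ^+ 2)%E) ->
      forall t : R, 0 < t < T ->
        (dist_L2norm t (RLderiv T beta y) <= (C * Num.sqrt eps)%:E)%E.
Proof.
set G := Gamma (1 - beta); set B := beta_int beta (1 - beta).
have G0 : 0 < G by apply: Gamma_gt0; lra.
have B0 : 0 < B.
  have b01 : 0 < beta <= 1 by lra.
  have a01 : 0 < 1 - beta <= 1 by lra.
  by have [_] := beta_int_spec _ _ b01 a01; rewrite -/B; lra.
pose c x : R := abel (beta + 1) x / beta.
have cT0 : 0 < c T by rewrite /c abel_gt0E// divr_gt0// powR_gt0.
have [K KE] : exists K, K = G ^+ 2 * (A * (B ^- 2 * c T)) by eexists.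
have K0 : 0 < K by rewrite KE mulr_gt0 ?exprn_gt0// mulr_gt0// mulr_gt0// invr_gt0 exprn_gt0.
(* the solution of [K * d ^ beta / beta = 1 / 2] *)
pose d := (beta / (2 * K)) `^ beta^-1.
have bK0 : 0 < beta / (2 * K) by rewrite divr_gt0// mulr_gt0.
have d0 : 0 < d by exact: powR_gt0.
have cd : c d = (2 * K)^-1.
  rewrite /c abel_gt0E// addrK -powRrM mulVf ?gt_eqF// powRr1 ?(ltW bK0)//.
  by field; rewrite !gt_eqF.
pose D := 2 * (K * c T).
have D0 : 0 <= D by rewrite ltW// /D mulr_gt0// mulr_gt0.
have [C C0 HC] := delay_gronwall D d (Num.truncn (T / d)).+1 D0 d0.
exists (Num.sqrt C); first by rewrite sqrtr_gt0.
move=> eps y e0 [Ly _] H t tT; have /andP[t0 tltT] := tT.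
have tleT := ltW tltT.
have [w [Lw rep]] : exists w, L2 t w /\ dist_represents t (RLderiv T beta y) w.
  have : (dist_L2norm t (RLderiv T beta y) < +oo)%E.
    apply: sqr_lty; apply: (le_lt_trans (H t tT)).
    by rewrite (L2norm_energy t T y tleT Ly) -EFinM -EFinD ltry.
  by move/ereal_inf_lt => [_ [w Hw _] _]; exists w.
have [mw fw] := L2P t w Lw.
pose W s := G * (w \_ `]0, t[) s.
have phiE s : energy W s = G ^+ 2 * energy (w \_ `]0, t[) s by exact: energyZ.
have step s : 0 < s <= t -> energy W s <= 2 * (G ^+ 2 * eps) + D * energy W (s - d).
  move=> /andP[s0 st]; have sT : 0 < s < T by lra.
  have sleT : s <= T by lra.
  have reps := dist_represents_le s t _ w st rep.
  have Lws := L2S s t w st Lw.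
  have := H s sT.
  rewrite (dist_L2norm_eq beta T s y w hbeta0 hbeta1 sleT Ly Lws reps).
  rewrite (L2norm_energy s t w st Lw) => h1.
  have := L2norm_le_energy beta T t s d y w hbeta0 hbeta1 tleT Ly Lw rep st (ltW d0).
  move=> /= h2.
  have {h1 h2} : ((energy (w \_ `]0, t[) s)%:E <= (eps + A * (B ^- 2 * c T *
     (c T * energy W (s - d) + c d * energy W s)))%:E)%E.
    apply: (le_trans h1); rewrite [leRHS]EFinD leeD2l// EFinM.
    by apply: lee_wpmul2l; [rewrite lee_fin ltW|exact: h2].
  rewrite lee_fin cd -(ler_pM2l (exprn_gt0 2 G0)) -phiE /D.
  move: (energy W (s - d)) (energy W s) (c T) KE => p q cT KE h.
  (* the last term below is half of the left-hand side, so it can be absorbed *)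
  have : q <= G ^+ 2 * eps + K * cT * p + 2^-1 * q.
    apply: (le_trans h).
    have -> : 2^-1 * q = K * ((2 * K)^-1 * q) by field; rewrite gt_eqF.
    by rewrite KE; lra.
  by lra.
have W0 s : s <= 0 -> energy W s <= 0.
  move=> s0; rewrite energy_le0// => r r0.
  by rewrite /W restrict_le0// mulr0.
have Ge0 : 0 <= G ^+ 2 * eps by rewrite mulr_ge0 ?sqr_ge0 ?ltW.
have tn : t <= (Num.truncn (T / d)).+1%:R * d.
  rewrite -ler_pdivrMr//; apply: (@le_trans _ _ (T / d)); first by rewrite ler_pM2r ?invr_gt0.
  exact/ltW/truncnS_gt.
have := HC (energy W) (G ^+ 2 * eps) t Ge0 W0 step t (lexx t) tn.
rewrite phiE mulrCA ler_pM2l ?exprn_gt0// => h.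
rewrite (dist_L2norm_eq beta T t y w hbeta0 hbeta1 tleT Ly Lw rep).
rewrite -lee_sqr ?Lnorm_ge0 ?lee_fin ?mulr_ge0 ?sqrtr_ge0//.
rewrite (L2norm_energy t t w (lexx t) Lw) -EFin_expe lee_fin exprMn.
by rewrite !sqr_sqrtr ?(ltW C0) ?(ltW e0).
Qed.
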